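(* Let $M=2m$ with $m\ge1$, let $N\ge 2$ with $N=2n$ or $N=2n+1$, and let $(\pi,V)$ be an irreducible lowest weight representation of $\mathfrak{osp}(M/N;\mathbb{R})$ with lowest weight $\lambda=(\lambda_1,\dots,\lambda_m/\mu_1,\dots,\mu_n)\in(\mathfrak{h}^{\mathbb{C}})^*$. Assume that $(\pi,V)$ is (infinitesimally) admissible. If $(\pi,V)$ is super unitary, then $$\lambda_1+\mu_1\in\{d,d+1,\dots,m-1\}\cup[m-1,\infty),$$ where $d=\#\{1\le k\le m\mid\lambda_k>\lambda_1\}$.
   Context: Lie superalgebra. $\mathfrak{g}=\mathfrak{osp}(M/N;\mathbb{R})$ ($M=2m$, $N=2n$ or $2n+1$) is the real Lie superalgebra spanned by the homogeneous $X\in\mathfrak{gl}(M/N;\mathbb{R})$ with $b(Xv,w)+(-1)^{\deg X\deg v}b(v,Xw)=0$ for all homogeneous $v,w$, where $b(v,w)={}^t v B w$ on the super space $\mathbb{R}^{M}\oplus\mathbb{R}^{N}$ (even part $\mathbb{R}^M$, odd part $\mathbb{R}^N$) and $B$ is block diagonal with blocks $\begin{pmatrix}0&1_m\\-1_m&0\end{pmatrix}$ and $1_N$. Cartan subalgebra. $\mathfrak{h}$ is the compact Cartan subalgebra of block diagonal matrices with upper block $\begin{pmatrix}0&A\\-A&0\end{pmatrix}$, $A=\mathrm{diag}(a_1,\dots,a_m)$, and lower block $\mathrm{diag}(b_1u,\dots,b_nu)$ (followed by one diagonal entry $0$ if $N$ is odd), $u=\begin{pmatrix}0&1\\-1&0\end{pmatrix}$,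 $a_i,b_j\in\mathbb{R}$. Define $e_i(h)=\sqrt{-1}\,a_i$, $f_j(h)=\sqrt{-1}\,b_j$, and write $\lambda=(\lambda_1,\dots,\lambda_m/\mu_1,\dots,\mu_n)$ for $\lambda=\sum_i\lambda_ie_i+\sum_j\mu_jf_j$. Positive roots. Even: $e_i-e_j$ ($i<j$), $e_i+e_j$ ($i\le j$), $f_i\pm f_j$ ($i<j$), and, if $N=2n+1$, also $f_j$. Odd: $e_i\pm f_j$, and, if $N=2n+1$, also $e_i$. $\mathfrak{g}^{-}\subset\mathfrak{g}^{\mathbb{C}}$ is the sum of the negative root spaces. A lowest weight representation with lowest weight $\lambda$ is one generated by a non-zero vector of weight $\lambda$ annihilated by $\mathfrak{g}^-$. Admissible. A representation of $\mathfrak{g}$ is infinitesimally admissible if its restriction to $\mathfrak{k}$, a maximal compact subalgebra of $\mathfrak{g}_{\bar 0}=\mathfrak{sp}(M;\mathbb{R})\oplus\mathfrak{so}(N)$ containing $\mathfrak{h}$, is a direct sum of irreducible finite dimensional representations with finite multiplicities. Super unitary. A representation $(\pi,V)$ of $\mathfrak{g}$ on a complex super space $V=V_{\bar 0}\oplus V_{\bar 1}$ is super unitary if there are a positive definite Hermitian form $\langle\cdot,\cdot\rangle$ on $V$ with $V_{\bar 0}\perp V_{\bar 1}$ and a constant $\varepsilon=\pm1$ such that, with $j\in\mathbb{C}$ satisfying $j^2=\varepsilon\sqrt{-1}$, one has $\langle\pi(X)v,w\rangle=-\langle v,\pi(X)w\rangle$ for all $X\in\mathfrak{g}_{\bar 0}$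 and $\langle j\pi(\xi)v,w\rangle=\langle v,j\pi(\xi)w\rangle$ for all $\xi\in\mathfrak{g}_{\bar 1}$. (The coordinates of weights of a super unitary representation are real, so the inequalities $\lambda_k>\lambda_1$ make sense.) *)

(* Defs.v *)
From mathcomp Require Export all_boot all_order all_algebra.
From mathcomp Require Export sesquilinear.
From mathcomp.real_closed Require Export complex.
From mathcomp Require Export reals.

Set Implicit Arguments.
Unset Strict Implicit.
Unset Printing Implicit Defensive.
Import Order.TTheory GRing.Theory Num.Theory.
Local Open Scope ring_scope.

Lemma rank_gt0 (n N : nat) :
  N = n.*2 \/ N = n.*2.+1 -> (2 <= N)%N -> (0 < n)%N.
Proof. by case: n => [|n] // [->|->]. Qed.

(* The notation 'i of ring_scope is a square root of -1 chosen abstractly; this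
   one is the imaginary unit that goes with complex.Re and complex.Im. *)
Definition im_unit (R : realType) : R[i] := Complex 0 1.

(* Parities are booleans: false is even, true is odd. *)

Section LieSuperalgebra.
Variables (R : realType) (m N : nat).

(* The super space is R^(m + m) (+) R^N, so the even part of a vector is its
   upper block and the odd part its lower block. *)

Definition homog_vec (s : bool) (v : 'cV[R]_(m + m + N)) : Prop :=
  if s then usubmx v = 0 else dsubmx v = 0.

Definition homog_mx (s : bool) (X : 'M[R]_(m + m + N)) : Prop :=
  if s then ulsubmx X = 0 /\ drsubmx X = 0
  else ursubmx X = 0 /\ dlsubmx X = 0.

Definition osp_gram : 'M[R]_(m + m + N) :=
  block_mx (block_mx 0 1%:M (- 1%:M) 0) 0 0 1%:M.

Definition osp_form (v w : 'cV[R]_(m + m + N)) : R :=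
  (v^T *m osp_gram *m w) 0 0.

Definition osp_homog (s : bool) (X : 'M[R]_(m + m + N)) : Prop :=
  homog_mx s X /\
  forall (t t' : bool) (v w : 'cV[R]_(m + m + N)),
    homog_vec t v -> homog_vec t' w ->
    osp_form (X *m v) w + (-1) ^+ (s && t) * osp_form v (X *m w) = 0.

Definition osp (X : 'M[R]_(m + m + N)) : Prop :=
  exists X0 X1, osp_homog false X0 /\ osp_homog true X1 /\ X = X0 + X1.

Definition superbracket (s t : bool) (X Y : 'M[R]_(m + m + N)) :
    'M[R]_(m + m + N) :=
  X *m Y - (-1) ^+ (s && t) *: (Y *m X).

Definition ospC (Z : 'M[R[i]]_(m + m + N)) : Prop :=
  osp (map_mx (@complex.Re R) Z) /\ osp (map_mx (@complex.Im R) Z).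

(* "Compact" is meant inside gl(M + N; R), as for the Lie algebra of a compact
   group of matrices: some inner product S on R^(M + N) is invariant.  (Being
   abstractly isomorphic to the Lie algebra of a compact group is not enough: a
   line spanned by a hyperbolic element would qualify.) *)
Definition compact_subalgebra (k : {pred 'M[R]_(m + m + N)}) : Prop :=
  [/\ submod_closed k,
      {in k, forall X, osp_homog false X},
      {in k &, forall X Y, superbracket false false X Y \in k} &
      exists S : 'M[R]_(m + m + N),
        [/\ S^T = S,
            forall v : 'cV[R]_(m + m + N), v != 0 -> 0 < (v^T *m S *m v) 0 0 &
            {in k, forall X, X^T *m S + S *m X = 0}]].

Definition maximal_compact_subalgebra (k : {pred 'M[R]_(m + m + N)}) : Prop :=
  compact_subalgebra k /\
  forall k' : {pred 'M[R]_(m + m + N)},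
    compact_subalgebra k' -> {subset k <= k'} -> {subset k' <= k}.

End LieSuperalgebra.

Section Roots.
Variables (R : realType) (m n N : nat).

(* diag(b_1 u, ..., b_n u), with u in rows and columns 2j, 2j+1 (from 0). *)
Definition rotation_blocks (b : 'rV[R]_n) : 'M[R]_N :=
  \matrix_(k < N, l < N) \sum_(j < n) b 0 j *
    (((k == j.*2 :> nat) && (l == j.*2.+1 :> nat))%:R
     - ((k == j.*2.+1 :> nat) && (l == j.*2 :> nat))%:R).

Definition cartan (a : 'rV[R]_m) (b : 'rV[R]_n) : 'M[R]_(m + m + N) :=
  block_mx (block_mx 0 (diag_mx a) (- diag_mx a) 0) 0 0 (rotation_blocks b).

(* (lambda_1, ..., lambda_m / mu_1, ..., mu_n) *)
Definition weight : Type := ('rV[R[i]]_m * 'rV[R[i]]_n)%type.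

Definition wt_e (i : 'I_m) : weight := (delta_mx 0 i, 0).
Definition wt_f (j : 'I_n) : weight := (0, delta_mx 0 j).

Definition eval_weight (lam : weight) (a : 'rV[R]_m) (b : 'rV[R]_n) : R[i] :=
  \sum_(i < m) lam.1 0 i * (im_unit R * (a 0 i)%:C%C)
  + \sum_(j < n) lam.2 0 j * (im_unit R * (b 0 j)%:C%C).

Inductive positive_root : weight -> Prop :=
| pos_eBe (i j : 'I_m) of (i < j)%N : positive_root (wt_e i - wt_e j)
| pos_eDe (i j : 'I_m) of (i <= j)%N : positive_root (wt_e i + wt_e j)
| pos_fBf (i j : 'I_n) of (i < j)%N : positive_root (wt_f i - wt_f j)
| pos_fDf (i j : 'I_n) of (i < j)%N : positive_root (wt_f i + wt_f j)
| pos_f (j : 'I_n) of odd N : positive_root (wt_f j)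
| pos_eBf (i : 'I_m) (j : 'I_n) : positive_root (wt_e i - wt_f j)
| pos_eDf (i : 'I_m) (j : 'I_n) : positive_root (wt_e i + wt_f j)
| pos_e (i : 'I_m) of odd N : positive_root (wt_e i).

Definition root_space (alpha : weight) (Z : 'M[R[i]]_(m + m + N)) : Prop :=
  ospC Z /\
  forall a b, let H := map_mx (real_complex R) (cartan a b) in
    H *m Z - Z *m H = eval_weight alpha a b *: Z.

Definition g_minus (Z : 'M[R[i]]_(m + m + N)) : Prop :=
  exists (p : nat) (alpha : 'I_p -> weight) (Y : 'I_p -> 'M[R[i]]_(m + m + N)),
    (forall i, positive_root (alpha i) /\ root_space (- alpha i) (Y i)) /\
    Z = \sum_(i < p) Y i.

End Roots.

Section Representations.
Variables (R : realType) (m N : nat) (V0 V1 : lmodType R[i]).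

(* A complex super space is a product V0 * V1, with even part V0 * {0} and odd
   part {0} * V1. *)
Local Notation V := (V0 * V1)%type.

Definition homog (s : bool) (v : V) : Prop :=
  if s then v.1 = 0 else v.2 = 0.

(* A representation is a function on all matrices of which only the values on
   osp matter. *)
Variable pi : 'M[R]_(m + m + N) -> V -> V.

Record is_representation : Prop := {
  rep_linear : forall X, osp X -> linear (pi X);
  rep_real_linear : forall (a : R) X Y v, osp X -> osp Y ->
    pi (a *: X + Y) v = (a%:C)%C *: pi X v + pi Y v;
  rep_parity : forall s t X v, osp_homog s X -> homog t v ->
    homog (s (+) t) (pi X v);
  rep_bracket : forall s t X Y v, osp_homog s X -> osp_homog t Y ->
    pi (superbracket s t X Y) v
    = pi X (pi Y v) - (-1) ^+ (s && t) *: pi Y (pi X v) }.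

Definition invariant (g : 'M[R]_(m + m + N) -> Prop) (U : {pred V}) : Prop :=
  forall X v, g X -> v \in U -> pi X v \in U.

Definition graded (U : {pred V}) : Prop :=
  forall v, v \in U -> (v.1, 0) \in U /\ (0, v.2) \in U.

Definition irreducible_rep : Prop :=
  (exists v : V, v != 0) /\
  forall U : {pred V},
    submod_closed U -> graded U -> invariant (@osp R m N) U ->
    (forall v, v \in U -> v = 0) \/ (forall v, v \in U).

Definition complexified (Z : 'M[R[i]]_(m + m + N)) (v : V) : V :=
  pi (map_mx (@complex.Re R) Z) v
  + im_unit R *: pi (map_mx (@complex.Im R) Z) v.

Definition lowest_weight_rep (n : nat) (lam : weight R m n) : Prop :=
  exists v : V,
    [/\ v != 0,
        forall a b, pi (cartan N a b) v = eval_weight lam a b *: v,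
        forall Z, @g_minus R m n N Z -> complexified Z v = 0 &
        forall U : {pred V},
          submod_closed U -> invariant (@osp R m N) U -> v \in U ->
          forall w, w \in U].

Section Restriction.
Variable k : {pred 'M[R]_(m + m + N)}.

Definition fin_dim (W : {pred V}) : Prop :=
  exists s : seq V, {in W, forall v,
    exists c : 'I_(size s) -> R[i], v = \sum_(i < size s) c i *: s`_i}.

Definition irreducible_sub (W : {pred V}) : Prop :=
  [/\ submod_closed W, invariant (fun X => X \in k) W,
      exists2 v, v \in W & v != 0 &
      forall U : {pred V},
        submod_closed U -> invariant (fun X => X \in k) U -> {subset U <= W} ->
        (forall v, v \in U -> v = 0) \/ {subset W <= U}].

Definition equivalent_sub (W W' : {pred V}) : Prop :=
  exists phi : V -> V,
    [/\ forall a, {in W &, forall u v, phi (a *: u + v) = a *: phi u + phi v},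
        {in W, forall v, phi v \in W'} /\ {in W &, injective phi},
        {in W', forall w, exists2 v, v \in W & phi v = w} &
        {in k & W, forall X v, phi (pi X v) = pi X (phi v)}].

Definition direct_sum (I : Type) (W : I -> {pred V}) : Prop :=
  (forall v, exists (p : nat) (f : 'I_p -> I) (w : 'I_p -> V),
     (forall i, w i \in W (f i)) /\ v = \sum_(i < p) w i) /\
  (forall (p : nat) (f : 'I_p -> I) (w : 'I_p -> V),
     injective f -> (forall i, w i \in W (f i)) ->
     \sum_(i < p) w i = 0 -> forall i, w i = 0).

Definition admissible : Prop :=
  exists (I : choiceType) (W : I -> {pred V}),
    [/\ direct_sum W,
        forall i, fin_dim (W i) /\ irreducible_sub (W i) &
        forall i, exists s : seq I,
          forall j, equivalent_sub (W i) (W j) -> j \in s].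

End Restriction.

Definition super_unitary : Prop :=
  exists (ip : {dot V for @Num.conj R[i]}) (eps j : R[i]),
    [/\ forall v w : V, homog false v -> homog true w -> ip v w = 0,
        eps = 1 \/ eps = -1,
        j ^+ 2 = eps * im_unit R,
        forall X v w, osp_homog false X -> ip (pi X v) w = - ip v (pi X w) &
        forall X v w, osp_homog true X ->
          ip (j *: pi X v) w = ip v (j *: pi X w)].

End Representations.

(* Main.v *)
(** Norms are computed inside a copy of gl(m|1) in osp(M/N; C).  Let [Q i] and
    [P i] be root vectors for e_i - f_1 and f_1 - e_i, normalized so that [P i]
    is adjoint to [Q i].  The [Q i] anticommute and [P i] kills the lowest weight
    vector v, whence, for t_1 < ... < t_k and h_i = lambda_i + mu_1,
      |Q t_1 ... Q t_k v|^2 = (h_(t_1) - (k-1)) ... (h_(t_k) - 0) |v|^2.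
    Positivity of these norms for the final segments of {1, ..., m}, with or
    without the index 1 added, forces h_1 to be one of d, ..., m - 1 or to be at
    least m - 1.  This is for the sign eps = -1; if eps = 1, the odd operators
    force lambda_i <= 0 and the long even roots lambda_i >= 0, so that all the
    lambda_i vanish and then lambda_1 + mu_1 = 0. *)

From HB Require Import structures.
Require Import Defs.
From mathcomp Require Import ring zify.

Set Implicit Arguments.
Unset Strict Implicit.
Unset Printing Implicit Defensive.
Import Order.TTheory GRing.Theory Num.Theory.
Local Open Scope ring_scope.

(** * Norms in the gl(m|1) ladder *)

Lemma dot_conjC (C : numClosedFieldType) (V : lmodType C)
  (ip : {dot V for @Num.conj C}) u w : ip u w = (ip w u)^*.
Proof. have := hermC ip u w; rewrite expr0 mul1r; exact. Qed.

Section OddLadder.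
Variables (C : numClosedFieldType) (V : lmodType C).
Variable ip : {dot V for @Num.conj C}.
Variables (m : nat) (Q P : 'I_m -> {linear V -> V}) (v : V) (h : 'I_m -> C).
Hypothesis v_neq0 : v != 0.
Hypothesis adjoint : forall i u w, ip (P i u) w = ip u (Q i w).
Hypothesis QQ : forall i k u, Q i (Q k u) = - Q k (Q i u).
(** The relation [[{P i, Q k}, Q l]] of gl(m|1), written out: the anticommutator acts on the [Q l]
    as a matrix unit, shifted by a scalar matrix when [i = k]. *)
Hypothesis PQQ : forall i k l u,
  P i (Q k (Q l u)) + Q k (P i (Q l u)) - (Q l (P i (Q k u)) + Q l (Q k (P i u)))
  = (i == l)%:R *: Q k u - (i == k)%:R *: Q l u.
Hypothesis Pv : forall i, P i v = 0.
Hypothesis PQv_lt : forall i k : 'I_m, (i < k)%N -> P i (Q k v) = 0.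
Hypothesis PQv : forall i, P i (Q i v) = h i *: v.

(** The even operator [{P i, Q k}]: a root vector of weight e_k - e_i for [k] different from [i], a
    Cartan element for [k = i]. *)
Let E k i u := P i (Q k u) + Q k (P i u).

Let EQ k i l u :
  E k i (Q l u) = Q l (E k i u) + (i == l)%:R *: Q k u - (i == k)%:R *: Q l u.
Proof. by rewrite -addrA -PQQ [Q l (E k i u)]linearD addrC subrK. Qed.

Definition ladder (s : seq 'I_m) : V := foldr Q v s.

(** For [i < k] the weight e_k - e_i is negative, so [E k i] kills [v]; by [EQ] it can only turn a
    factor [Q i] into [Q k], and no such factor occurs. *)
Let E_ladder_lt (k i : 'I_m) s : (i < k)%N ->
  i \notin s -> E k i (ladder s) = 0.
Proof.
move=> ik; elim: s => [_|l s IH] /=.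
  by rewrite /E Pv linear0 PQv_lt // addr0.
rewrite inE negb_or => /andP[il si].
by rewrite EQ IH // linear0 (negPf il) -(inj_eq val_inj) /= ltn_eqF // !scale0r
  addr0 subr0.
Qed.

(** Moving [P i] past the first factor [Q k] costs [E k i] applied to the rest, which vanishes by
    [E_ladder_lt]. *)
Let P_ladder (i : 'I_m) s : all (fun k : 'I_m => i < k)%N s -> P i (ladder s) = 0.
Proof.
elim: s => [_|k s IH] /=; first exact: Pv.
move=> /andP[ik si]; have := @E_ladder_lt k i s ik.
rewrite /E IH // linear0 addr0; apply.
by apply/negP => /(allP si); rewrite ltnn.
Qed.

(** [E i i] starts with the eigenvalue [h i] on [v], and each [Q l] with [l] different from [i]
    lowers the eigenvalue by one. *)
Let E_ladder_diag (i : 'I_m) s : i \notin s ->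
  E i i (ladder s) = (h i - (size s)%:R) *: ladder s.
Proof.
elim: s => [_|l s IH] /=; first by rewrite /E Pv linear0 PQv addr0 subr0.
rewrite inE negb_or => /andP[il si].
rewrite EQ IH // (negPf il) eqxx scale0r addr0 linearZ scale1r.
by rewrite -{2}[Q l _]scale1r -scalerBl -addrA -opprD -[in RHS]addn1 natrD.
Qed.

(** By adjunction the norm involves [P i (Q i (ladder s))], which is [E i i (ladder s)] because
    [P i] kills the shorter ladder. *)
Lemma norm_ladder_cons (i : 'I_m) s : all (fun k : 'I_m => i < k)%N s ->
  ip (ladder (i :: s)) (ladder (i :: s))
  = (h i - (size s)%:R) * ip (ladder s) (ladder s).
Proof.
move=> si; have nsi : i \notin s by apply/negP => /(allP si); rewrite ltnn.
have := E_ladder_diag nsi; rewrite /E P_ladder // linear0 addr0 => e.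
by rewrite /= -adjoint e linearZl_LR.
Qed.

(* [P j (Q i v)] is the image of [v] under the even raising operator of weight
   e_i - e_j; the inequality is the positivity of its norm. *)
Lemma ladder_value_homo (i j : 'I_m) : (i < j)%N -> h i <= h j.
Proof.
move=> ij; have ji : (j == i) = false by rewrite -(inj_eq val_inj) /= gtn_eqF.
have adjoint' u w : ip u (P j w) = ip (Q j u) w.
  by rewrite dot_conjC adjoint -dot_conjC.
have QPQ : Q j (P j (Q i v)) = (h j - 1) *: Q i v - P j (Q j (Q i v)).
  have := @E_ladder_diag j [:: i]; rewrite inE ji => /(_ isT) /= <-.
  by rewrite /E addrC addKr.
have nQ k : ip (Q k v) (Q k v) = h k * ip v v.
  by have := @norm_ladder_cons k [::]; rewrite subr0; apply.
have nQQ : ip (Q j (Q i v)) (Q j (Q i v)) = (h i - 1) * (h j * ip v v).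
  (* [norm_ladder_cons] requires the smaller index in front; the sign from the swap enters twice and
     cancels. *)
  rewrite QQ linearNl linearNr opprK.
  by have := @norm_ladder_cons i [:: j]; rewrite /= ij nQ; apply.
have := dnorm_ge0 ip (P j (Q i v)).
rewrite adjoint' QPQ linearBl /= adjoint linearZl_LR /= nQQ nQ.
rewrite -subr_ge0 (_ : _ - _ = (h j - h i) * ip v v); last by ring.
by rewrite pmulr_lge0 ?dnorm_gt0 // subr_ge0.
Qed.

Let tail n := drop n (enum 'I_m).

Let tail_ge n (i : 'I_m) : i \in tail n -> (n <= i)%N.
Proof.
move=> /(map_f val); rewrite map_drop val_enum_ord drop_iota mem_iota add0n.
by case/andP.
Qed.

Let tail_lt (n : nat) (i : 'I_m) : (n < m)%N -> (i <= n)%N ->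
  all (fun k : 'I_m => i < k)%N (tail n.+1).
Proof. by move=> nm ni; apply/allP => k /tail_ge; apply: leq_trans. Qed.

Let size_tail n : size (tail n) = (m - n)%N.
Proof. by rewrite size_drop size_enum_ord. Qed.

Let tail_cons (i : 'I_m) : tail i = i :: tail i.+1.
Proof.
by rewrite /tail (drop_nth i) ?size_enum_ord // nth_ord_enum.
Qed.

(** Final segments of indices are lengthened downward from the empty one. Either all the norms down
    to the segment starting at index 1 stay positive, which gives the bound m - 1, or a norm
    vanishes for the first time, and this pins [h i0] to an integer. *)
Lemma ladder_value_trichotomy (i0 : 'I_m) : i0 = 0%N :> nat ->
  let d := #|[set i : 'I_m | h i0 < h i]| in
  (exists p : nat, (d <= p <= m.-1)%N /\ h i0 = p%:R) \/ (m.-1)%:R <= h i0.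
Proof.
move=> i00 d; have m_gt0 : (0 < m)%N by rewrite -i00.
pose N n := ip (ladder (tail n)) (ladder (tail n)).
(* Prefixing [i0] multiplies the norm of a segment by [h i0] minus its length, and the product
   cannot be negative. *)
have x_ge n : (n < m)%N -> 0 < N n.+1 -> (m - n.+1)%:R <= h i0.
  move=> nm Nn; have := dnorm_ge0 ip (ladder (i0 :: tail n.+1)).
  rewrite norm_ladder_cons; last by apply: tail_lt; rewrite ?i00.
  by rewrite size_tail pmulr_lge0 // subr_ge0.
suff [|/(x_ge _ m_gt0)] :
  (exists p : nat, (d <= p <= m.-1)%N /\ h i0 = p%:R) \/ 0 < N 1%N.
- by left.
- by rewrite subn1; right.
(* Induction on the length [t] of the segment; [t = 0] is the empty ladder, that is, [v] itself. *)
have [t ->] : exists t, 1%N = (m - t)%N by exists m.-1; lia.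
elim: t => [|t [|IH]]; first by right; rewrite /N /tail subn0 drop_oversize
  ?size_enum_ord // dnorm_gt0.
  by left.
(* For [t] at least [m] truncated subtraction keeps the starting index at 0, and the claim
   repeats. *)
have [le_mt|lt_tm] := leqP m t.
  by right; move: IH; rewrite (_ : m - t = m - t.+1)%N //; lia.
have nm : (m - t.+1 < m)%N by lia.
pose i := Ordinal nm; have eS : (m - t.+1).+1 = (m - t)%N by lia.
have := x_ge _ nm; rewrite eS (_ : m - (m - t) = t)%N; last by lia.
move=> /(_ IH) t_le_x.
have x_le_hi : h i0 <= h i.
  have [-> //|ne] := eqVneq i0 i; apply: ladder_value_homo.
  rewrite i00 lt0n; apply: contra ne => /eqP i0'; apply/eqP/val_inj.
  exact: etrans i00 (esym i0').
have Nt : N (m - t.+1)%N = (h i - t%:R) * N (m - t)%N.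
  rewrite /N (tail_cons i) norm_ladder_cons; last exact: (@tail_lt i).
  by rewrite eS size_tail (_ : m - (m - t) = t)%N //; lia.
(* Since [t <= h i0 <= h i], the new factor [h i - t] is positive, and the induction goes on, or
   zero, and then [h i0 = h i = t]. *)
have [hit|hit] := eqVneq (h i) t%:R; last first.
  right; rewrite Nt mulr_gt0 // subr_gt0 lt_neqAle eq_sym hit.
  exact: le_trans x_le_hi.
left; exists t; have xt : h i0 = t%:R by apply/le_anti; rewrite t_le_x -hit x_le_hi.
split=> //; apply/andP; split; last by lia.
(* For [d <= t]: by monotonicity of [h], an index whose value exceeds [h i] lies strictly above [i],
   and there are only [t] such places. *)
suff sd : {subset [set k : 'I_m | h i0 < h k] <= tail i.+1}.
  have /subset_leq_card/leq_trans : [set k : 'I_m | h i0 < h k] \subset tail i.+1.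
    exact/subsetP.
  apply; by apply: leq_trans (card_size _) _; rewrite size_tail /=; lia.
move=> k; rewrite inE xt => hk.
rewrite -(mem_map val_inj) map_drop val_enum_ord drop_iota mem_iota.
rewrite subnKC // add0n ltn_ord andbT.
rewrite ltnNge; apply/negP => ki; move: hk; apply/negP.
  have [->|ne] := eqVneq k i; first by rewrite hit ltxx.
  have : h k <= h i.
    by apply: ladder_value_homo; rewrite ltn_neqAle -(inj_eq val_inj) in ne *; rewrite ne.
  by rewrite hit => le_hk; apply/negP => /lt_geF; rewrite le_hk.
Qed.

End OddLadder.

(** * Odd matrices of osp(M/N) *)

Section OddMatrices.
Variables (K : comNzRingType) (m N : nat).

Definition symp_gram : 'M[K]_(m + m) := block_mx 0 1%:M (- 1%:M) 0.
Local Notation J := symp_gram.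

Definition even_mx A D : 'M[K]_(m + m + N) := block_mx A 0 0 D.
(** Invariance of the form forces the lower left block, so the odd part of osp is parametrized by
    its upper right block [B]. *)
Definition odd_mx (B : 'M[K]_(m + m, N)) : 'M[K]_(m + m + N) :=
  block_mx 0 B (B^T *m J) 0.

Definition cartan_symp (a : 'rV[K]_m) : 'M[K]_(m + m) :=
  block_mx 0 (diag_mx a) (- diag_mx a) 0.

Lemma even_mxZ a A D : a *: even_mx A D = even_mx (a *: A) (a *: D).
Proof. by rewrite /even_mx scale_block_mx !scaler0. Qed.

Lemma tr_symp_gram : J^T = - J.
Proof.
by rewrite /symp_gram tr_block_mx opp_block_mx !trmx0 oppr0 linearN /= trmx1 opprK.
Qed.

Lemma odd_mxP a B B' : odd_mx (a *: B + B') = a *: odd_mx B + odd_mx B'.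
Proof.
by rewrite /odd_mx scale_block_mx add_block_mx !scaler0 !addr0 linearP /=
  mulmxDl scalemxAl.
Qed.

Lemma odd_mx0 : odd_mx 0 = 0.
Proof. by rewrite /odd_mx trmx0 mul0mx block_mx0. Qed.

Lemma odd_mx_anticomm B B' :
  odd_mx B *m odd_mx B' + odd_mx B' *m odd_mx B
  = even_mx ((B *m B'^T + B' *m B^T) *m J) (B^T *m J *m B' + B'^T *m J *m B).
Proof.
rewrite /odd_mx /even_mx !mulmx_block add_block_mx.
by rewrite !mul0mx !mulmx0 !addr0 !add0r mulmxDl !mulmxA.
Qed.

(** With [A] in sp and [D] in so, the lower left block of the commutator is again the one that
    [odd_mx] prescribes. *)
Lemma even_odd_mx_comm A D B : A^T *m J + J *m A = 0 -> D^T + D = 0 ->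
  even_mx A D *m odd_mx B - odd_mx B *m even_mx A D = odd_mx (A *m B - B *m D).
Proof.
move=> /eqP; rewrite addr_eq0 => /eqP hA /eqP; rewrite addr_eq0 => /eqP hD.
rewrite /odd_mx /even_mx !mulmx_block opp_block_mx add_block_mx.
rewrite !mul0mx !mulmx0 !(addr0, add0r, subr0, oppr0).
rewrite linearB /= !trmx_mul mulmxBl hD -!mulmxA hA.
by rewrite mulNmx mulmxN !opprK [- _ + _]addrC !mulmxA.
Qed.

(** The parameter of [[{odd_mx B, odd_mx B'}, odd_mx B'']]; with it double brackets can be computed
    on upper right blocks alone. *)
Definition odd_triple B B' B'' : 'M[K]_(m + m, N) :=
  (B *m B'^T + B' *m B^T) *m J *m B'' - B'' *m (B^T *m J *m B' + B'^T *m J *m B).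

Lemma odd_mx_triple B B' B'' :
  let X := odd_mx B *m odd_mx B' + odd_mx B' *m odd_mx B in
  X *m odd_mx B'' - odd_mx B'' *m X = odd_mx (odd_triple B B' B'').
Proof.
rewrite /= odd_mx_anticomm; apply: even_odd_mx_comm.
  rewrite !trmx_mul tr_symp_gram linearD /= !trmx_mul !trmxK !mulNmx mulmxA.
  by rewrite [B' *m _ + _]addrC addNr.
rewrite linearD /= !trmx_mul tr_symp_gram !trmxK !mulNmx !mulmxN !mulmxA.
by rewrite [in X in _ + X]addrC -opprD addNr.
Qed.

Definition sdot (x x' : 'cV[K]_(m + m)) : K := (x^T *m J *m x') 0 0.
Definition vdot (y y' : 'cV[K]_N) : K := (y^T *m y') 0 0.

Lemma mul_rank1_tr (x x' : 'cV[K]_(m + m)) y y' :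
  (x *m y^T) *m (x' *m y'^T)^T = vdot y y' *: (x *m x'^T).
Proof.
rewrite trmx_mul trmxK !mulmxA -[x *m y^T *m y']mulmxA [y^T *m y']mx11_scalar.
by rewrite mul_mx_scalar -scalemxAl.
Qed.

Lemma tr_mul_rank1 x x' (y y' : 'cV[K]_N) :
  (x *m y^T)^T *m J *m (x' *m y'^T) = sdot x x' *: (y *m y'^T).
Proof.
rewrite trmx_mul trmxK !mulmxA -2![y *m _ *m _]mulmxA [x^T *m _ *m _]mx11_scalar.
by rewrite mul_mx_scalar -scalemxAl.
Qed.

Lemma odd_tripleZ a b c B B' B'' :
  odd_triple (a *: B) (b *: B') (c *: B'') = (a * b * c) *: odd_triple B B' B''.
Proof.
rewrite /odd_triple ![(_ *: _)^T]linearZ /=.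
rewrite !(=^~ scalemxAl, =^~ scalemxAr, scalerA).
rewrite [b * a]mulrC -!scalerDr -!scalemxAl -!scalemxAr !scalerA.
by rewrite [c * _]mulrC scalerBr.
Qed.

(** On decomposable tensors every inner product of factors is a 1 x 1 matrix and comes out as a
    scalar; relations among root vectors thus reduce to values of the two pairings. *)
Lemma odd_triple_rank1 x x' x'' y y' y'' :
  odd_triple (x *m y^T) (x' *m y'^T) (x'' *m y''^T)
  = (vdot y y' * sdot x' x'') *: (x *m y''^T)
    + (vdot y' y * sdot x x'') *: (x' *m y''^T)
    - ((vdot y'' y * sdot x x') *: (x'' *m y'^T)
       + (vdot y'' y' * sdot x' x) *: (x'' *m y^T)).
Proof.
have R1 (p q : nat) (u : 'cV[K]_p) (s t : 'M[K]_1) (w : 'rV[K]_q) :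
    u *m s *m t *m w = (s 0 0 * t 0 0) *: (u *m w).
  rewrite [s]mx11_scalar [t]mx11_scalar !mul_mx_scalar !mxE eqxx !mulr1n.
  by rewrite -!scalemxAl scalerA mulrC.
rewrite /odd_triple /vdot /sdot !trmx_mul !trmxK !mulmxDl !mulmxDr !mulmxA.
by rewrite -!R1 !mulmxA.
Qed.

Lemma cartan_symp_skew (a : 'rV[K]_m) :
  (cartan_symp a)^T *m J + J *m cartan_symp a = 0.
Proof.
rewrite /cartan_symp /symp_gram tr_block_mx [(- _)^T]linearN /= tr_diag_mx !trmx0.
rewrite !mulmx_block !mul0mx !mulmx0 !mul1mx !mulmx1 !mulNmx !mulmxN !mul1mx !mulmx1.
by rewrite !(addr0, add0r) opprK add_block_mx !addr0 !addrN block_mx0.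
Qed.

End OddMatrices.

(** * The real form *)

Section RealForm.
Variables (R : realType) (m N : nat).
Local Notation M := 'M[R]_(m + m + N).
Implicit Types (X Y : M) (v w : 'cV[R]_(m + m + N)).

Lemma osp_formE v w : osp_form v w
  = ((usubmx v)^T *m symp_gram R m *m usubmx w + (dsubmx v)^T *m dsubmx w) 0 0.
Proof.
rewrite /osp_form -{1}(vsubmxK v) -{1}(vsubmxK w) tr_col_mx.
rewrite /osp_gram -/(symp_gram R m) mul_row_block mul_row_col.
by rewrite !mulmx0 mulmx1 addr0 add0r.
Qed.

Lemma osp_formDl v v' w : osp_form (v + v') w = osp_form v w + osp_form v' w.
Proof. by rewrite /osp_form linearD /= !mulmxDl !mxE. Qed.
Lemma osp_formDr v w w' : osp_form v (w + w') = osp_form v w + osp_form v w'.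
Proof. by rewrite /osp_form !mulmxDr !mxE. Qed.
Lemma osp_formZl a v w : osp_form (a *: v) w = a * osp_form v w.
Proof. by rewrite /osp_form linearZ /= -!scalemxAl !mxE. Qed.
Lemma osp_formZr a v w : osp_form v (a *: w) = a * osp_form v w.
Proof. by rewrite /osp_form -!scalemxAr !mxE. Qed.

Lemma homog_mx_lin s a X Y : homog_mx s X -> homog_mx s Y -> homog_mx s (a *: X + Y).
Proof.
by case: s => -[e1 e2] [f1 f2]; split; [move: e1 f1|move: e2 f2|move: e1 f1|move: e2 f2];
  rewrite /ulsubmx /ursubmx /dlsubmx /drsubmx linearP linearP /= => -> ->;
  rewrite scaler0 addr0.
Qed.

Lemma osp_homog_lin s a X Y :
  osp_homog s X -> osp_homog s Y -> osp_homog s (a *: X + Y).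
Proof.
move=> [hX bX] [hY bY]; split; first exact: homog_mx_lin.
move=> t t' v w hv hw; have := bX _ _ _ _ hv hw; have := bY _ _ _ _ hv hw.
rewrite !mulmxDl -!scalemxAl osp_formDl osp_formDr osp_formZl osp_formZr => eY eX.
rewrite mulrDr addrACA eY addr0 mulrCA -mulrDr eX mulr0 //.
Qed.

Lemma homog_mx_vec s t X v : homog_mx s X -> homog_vec t v -> homog_vec (s (+) t) (X *m v).
Proof.
rewrite -{2}(submxK X) -{2}(vsubmxK v) mul_block_col /homog_mx /homog_vec.
by case: s => -[e1 e2]; case: t => e;
  rewrite /= ?col_mxKu ?col_mxKd e ?e1 ?e2
  ?mulmx0 ?mul0mx addr0.
Qed.

Lemma homog_mx_mul s t X Y : homog_mx s X -> homog_mx t Y -> homog_mx (s (+) t) (X *m Y).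
Proof.
rewrite -{2}(submxK X) -{2}(submxK Y) mulmx_block /homog_mx.
case: s => -[e1 e2]; case: t => -[f1 f2];
by rewrite /= ?block_mxKul ?block_mxKur ?block_mxKdl ?block_mxKdr ?e1 ?e2 ?f1 ?f2
  ?mulmx0 ?mul0mx !addr0.
Qed.

Lemma superbracketE s t X Y :
  superbracket s t X Y = - (-1) ^+ (s && t) *: (Y *m X) + X *m Y.
Proof. by rewrite /superbracket scaleNr addrC. Qed.

Lemma osp_homog_bracket s t X Y : osp_homog s X -> osp_homog t Y ->
  osp_homog (s (+) t) (superbracket s t X Y).
Proof.
move=> [hX bX] [hY bY]; rewrite superbracketE; split.
  by apply: homog_mx_lin; [rewrite addbC|]; apply: homog_mx_mul.
move=> r r' v w hv hw.
(* The factors cross the form one at a time; the first to cross meets a vector whose parity the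
   other has already shifted. *)
have XYl := bX _ _ _ _ (homog_mx_vec hY hv) hw.
have XYr := bY _ _ _ _ hv (homog_mx_vec hX hw).
have YXl := bY _ _ _ _ (homog_mx_vec hX hv) hw.
have YXr := bX _ _ _ _ hv (homog_mx_vec hY hw).
rewrite !mulmxDl -!scalemxAl osp_formDl osp_formDr osp_formZl osp_formZr -!mulmxA.
move/eqP: XYl; rewrite addr_eq0 => /eqP ->; move/eqP: XYr; rewrite addr_eq0 => /eqP XYr.
move/eqP: YXl; rewrite addr_eq0 => /eqP ->; move/eqP: YXr; rewrite addr_eq0 => /eqP YXr.
rewrite XYr YXr.
by case: s {hX bX XYr YXr} => //; case: t {hY bY}; case: r {hv} => /=; ring.
Qed.

Lemma osp_homog_odd_mx B : osp_homog true (@odd_mx R m N B).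
Proof.
split; first by rewrite /homog_mx /odd_mx block_mxKul block_mxKdr.
have mulE v : odd_mx B *m v = col_mx (B *m dsubmx v) (B^T *m symp_gram R m *m usubmx v).
  by rewrite -{1}(vsubmxK v) mul_block_col !mul0mx add0r addr0.
move=> t t' v w; rewrite !osp_formE !mulE !col_mxKu !col_mxKd.
rewrite !trmx_mul tr_symp_gram trmxK /homog_vec.
have z00 : (0 : 'M[R]_1) 0 0 = 0 by rewrite mxE.
have N00 (X : 'M[R]_1) : (- X) 0 0 = - X 0 0 by rewrite mxE.
case: t => [->|->]; case: t' => [->|->];
  rewrite ?(trmx0, mul0mx, mulmx0, addr0, add0r) ?z00 ?mulr0 ?addr0 //
    ?expr1 ?expr0 ?mulN1r ?mul1r ?(mulNmx, mulmxN) ?N00 ?mulmxA ?subrr ?addNr ?mulr0 //.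
Qed.

End RealForm.

(** * The complexified representation *)

Section Complexification.
Variables (R : realType).
Local Notation Re_mx := (map_mx (@complex.Re R)).
Local Notation Im_mx := (map_mx (@complex.Im R)).
Local Notation I := (im_unit R).
Local Notation toC := (map_mx (real_complex R)).

Lemma im_unit_sqr : I * I = -1.
Proof. by rewrite -expr2 sqr_i. Qed.

Lemma complex_im_unitE (z : R[i]) : z = (complex.Re z)%:C%C + I * (complex.Im z)%:C%C.
Proof. exact: complexE. Qed.

Lemma complex_ReD (y z : R[i]) : complex.Re (y + z) = complex.Re y + complex.Re z.
Proof. by case: y; case: z. Qed.
Lemma complex_ImD (y z : R[i]) : complex.Im (y + z) = complex.Im y + complex.Im z.
Proof. by case: y; case: z. Qed.
Lemma complex_ReM (y z : R[i]) : complex.Re (y * z)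
  = complex.Re y * complex.Re z - complex.Im y * complex.Im z.
Proof. by case: y; case: z. Qed.
Lemma complex_ImM (y z : R[i]) : complex.Im (y * z)
  = complex.Re y * complex.Im z + complex.Im y * complex.Re z.
Proof. by case: y; case: z. Qed.

Lemma Re_mx_lin p q a (X Y : 'M[R[i]]_(p, q)) : Re_mx (a *: X + Y)
  = complex.Re a *: Re_mx X + (- complex.Im a *: Im_mx X + Re_mx Y).
Proof. by apply/matrixP => i j; rewrite !mxE complex_ReD complex_ReM mulNr addrA. Qed.
Lemma Im_mx_lin p q a (X Y : 'M[R[i]]_(p, q)) : Im_mx (a *: X + Y)
  = complex.Re a *: Im_mx X + (complex.Im a *: Re_mx X + Im_mx Y).
Proof. by apply/matrixP => i j; rewrite !mxE complex_ImD complex_ImM addrA. Qed.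

Lemma Re_mxM p q r (X : 'M[R[i]]_(p, q)) (Y : 'M[R[i]]_(q, r)) :
  Re_mx (X *m Y) = Re_mx X *m Re_mx Y - Im_mx X *m Im_mx Y.
Proof.
apply/matrixP => i j; rewrite !mxE.
rewrite (big_morph _ complex_ReD (erefl : complex.Re (0 : R[i]) = 0)) -sumrB.
by apply: eq_bigr => l _; rewrite complex_ReM !mxE.
Qed.
Lemma Im_mxM p q r (X : 'M[R[i]]_(p, q)) (Y : 'M[R[i]]_(q, r)) :
  Im_mx (X *m Y) = Re_mx X *m Im_mx Y + Im_mx X *m Re_mx Y.
Proof.
apply/matrixP => i j; rewrite !mxE.
rewrite (big_morph _ complex_ImD (erefl : complex.Im (0 : R[i]) = 0)) -big_split.
by apply: eq_bigr => l _; rewrite complex_ImM !mxE.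
Qed.

Variables (m N : nat).
Local Notation M := 'M[R[i]]_(m + m + N).

Definition ospC_homog (s : bool) (Z : M) : Prop :=
  osp_homog s (Re_mx Z) /\ osp_homog s (Im_mx Z).

Lemma osp_homog0 s : osp_homog s (0 : 'M[R]_(m + m + N)).
Proof.
split; first by case: s; split; apply/matrixP => i j; rewrite !mxE.
by move=> *; rewrite !mul0mx /osp_form trmx0 mul0mx mulmx0 mul0mx mxE mulr0 addr0.
Qed.

Lemma osp_homogP s (X : 'M[R]_(m + m + N)) : osp_homog s X -> osp X.
Proof.
by case: s => hX; [exists 0, X|exists X, 0]; rewrite ?add0r ?addr0;
  split=> //; [exact: osp_homog0| split=> //; exact: osp_homog0].
Qed.

Lemma ospC_homogP s Z : ospC_homog s Z -> ospC Z.
Proof. by case=> hR hI; split; apply: osp_homogP; eassumption. Qed.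

Lemma ospC_homog_lin s a X Y :
  ospC_homog s X -> ospC_homog s Y -> ospC_homog s (a *: X + Y).
Proof.
by move=> [Xr Xi] [Yr Yi]; split; rewrite ?Re_mx_lin ?Im_mx_lin;
  apply: osp_homog_lin => //; apply: osp_homog_lin.
Qed.

Lemma ospC_homog0 s : ospC_homog s 0.
Proof.
have z (f : R[i] -> R) : f 0 = 0 -> map_mx f (0 : M) = 0.
  by move=> f0; apply/matrixP => i j; rewrite !mxE.
by split; rewrite z //; exact: osp_homog0.
Qed.

Lemma ospC_homogZ s a X : ospC_homog s X -> ospC_homog s (a *: X).
Proof.
by move=> hX; rewrite -[_ *: _]addr0; apply: ospC_homog_lin; last exact: ospC_homog0.
Qed.

Definition superbracketC s t (X Y : M) : M := X *m Y - (-1) ^+ (s && t) *: (Y *m X).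

Lemma Re_superbracketC s t X Y : Re_mx (superbracketC s t X Y)
  = -1 *: superbracket s t (Im_mx X) (Im_mx Y) + superbracket s t (Re_mx X) (Re_mx Y).
Proof.
have e (b : bool) (Z : M) : Re_mx ((-1) ^+ b *: Z) = (-1) ^+ b *: Re_mx Z.
  by apply/matrixP => i j; case: b; rewrite !mxE complex_ReM /= ?oppr0 mul0r subr0.
rewrite /superbracketC /superbracket -[X *m Y - _]addrC -scaleN1r Re_mx_lin /=.

rewrite !oppr0 scale0r add0r e !Re_mxM scalerBr !scaleN1r !opprB.
by rewrite addrACA [RHS]addrACA [X in _ = _ + X]addrC.
Qed.

Lemma Im_superbracketC s t X Y : Im_mx (superbracketC s t X Y)
  = superbracket s t (Re_mx X) (Im_mx Y) + superbracket s t (Im_mx X) (Re_mx Y).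
Proof.
have e (b : bool) (Z : M) : Im_mx ((-1) ^+ b *: Z) = (-1) ^+ b *: Im_mx Z.
  by apply/matrixP => i j; case: b; rewrite !mxE complex_ImM /= ?oppr0 mul0r addr0.
rewrite /superbracketC /superbracket -[X *m Y - _]addrC -scaleN1r Im_mx_lin /=.
rewrite !oppr0 !scale0r add0r e !Im_mxM scaleN1r scalerDr opprD.
by rewrite addrC [- _ - _]addrC addrACA.
Qed.

Lemma ospC_homog_bracket s t X Y : ospC_homog s X -> ospC_homog t Y ->
  ospC_homog (s (+) t) (superbracketC s t X Y).
Proof.
move=> [Xr Xi] [Yr Yi]; split.
  by rewrite Re_superbracketC; apply: osp_homog_lin; apply: osp_homog_bracket.
rewrite Im_superbracketC -[superbracket _ _ (Re_mx _) _]scale1r.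
by apply: osp_homog_lin; apply: osp_homog_bracket.
Qed.

Lemma toC_symp_gram : symp_gram R[i] m = toC (symp_gram R m).
Proof. by rewrite /symp_gram map_block_mx !map_mx0 map_mxN map_mx1. Qed.

Lemma Re_toC p q (X : 'M[R]_(p, q)) : Re_mx (toC X) = X.
Proof. by apply/matrixP => i j; rewrite !mxE. Qed.

Lemma Im_toC p q (X : 'M[R]_(p, q)) : Im_mx (toC X) = 0.
Proof. by apply/matrixP => i j; rewrite !mxE. Qed.

Lemma Re_odd_mx B : Re_mx (@odd_mx R[i] m N B) = odd_mx (Re_mx B).
Proof.
rewrite /odd_mx map_block_mx Re_mxM toC_symp_gram Re_toC Im_toC mulmx0 subr0 map_trmx.
by congr block_mx; apply/matrixP => i j; rewrite !mxE.
Qed.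

Lemma Im_odd_mx B : Im_mx (@odd_mx R[i] m N B) = odd_mx (Im_mx B).
Proof.
rewrite /odd_mx map_block_mx Im_mxM toC_symp_gram Re_toC Im_toC mulmx0 add0r map_trmx.
by congr block_mx; apply/matrixP => i j; rewrite !mxE.
Qed.

Lemma ospC_homog_odd_mx B : ospC_homog true (@odd_mx R[i] m N B).
Proof. by split; rewrite ?Re_odd_mx ?Im_odd_mx; exact: osp_homog_odd_mx. Qed.

(** * The complex linear extension of [pi] and the rescaled odd operators *)

Section ComplexifiedRep.
Variables (V0 V1 : lmodType R[i]).
Local Notation V := (V0 * V1)%type.
Variable pi : 'M[R]_(m + m + N) -> V -> V.
Hypothesis hpi : is_representation pi.
Local Notation piC := (complexified pi).

Lemma complexified_linear s Z : ospC_homog s Z -> linear (piC Z).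
Proof.
move=> [/osp_homogP/(rep_linear hpi) hr /osp_homogP/(rep_linear hpi) hi] a u w.
rewrite /complexified hr hi !scalerDr addrACA; congr (_ + _).
by rewrite !scalerA mulrC.
Qed.

Lemma complexifiedZ s Z a u : ospC_homog s Z -> piC Z (a *: u) = a *: piC Z u.
Proof.
move=> /complexified_linear lZ; have := lZ (-1) 0 0; rewrite scaler0 addr0 scaleN1r addNr.
by move=> Z0; have := lZ a u 0; rewrite Z0 !addr0.
Qed.

Lemma complexified_mx_lin s a X Y u : ospC_homog s X -> ospC_homog s Y ->
  piC (a *: X + Y) u = a *: piC X u + piC Y u.
Proof.
move=> [Xr Xi] [Yr Yi]; rewrite /complexified Re_mx_lin Im_mx_lin.
rewrite !(rep_real_linear hpi); try by apply: osp_homogP;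
  try apply: (osp_homog_lin (s := s)); eassumption.
set p := pi (Re_mx X) u; set q := pi (Im_mx X) u.
have -> : a *: (p + I *: q) =
    ((complex.Re a)%:C%C *: p + (- complex.Im a)%:C%C *: q)
    + I *: ((complex.Re a)%:C%C *: q + (complex.Im a)%:C%C *: p).
  rewrite [in LHS](complex_im_unitE a) scalerDl !scalerDr !scalerA mulrAC im_unit_sqr mulN1r.
  by rewrite rmorphN ![I * _]mulrC !addrA [LHS](ACl (1*4*2*3)).
by rewrite [RHS]addrACA -scalerDr -!addrA.
Qed.

Lemma complexified_comp s t X Y u : ospC_homog s X -> ospC_homog t Y ->
  piC X (piC Y u) = (pi (Re_mx X) (pi (Re_mx Y) u) - pi (Im_mx X) (pi (Im_mx Y) u))
    + I *: (pi (Re_mx X) (pi (Im_mx Y) u) + pi (Im_mx X) (pi (Re_mx Y) u)).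
Proof.
move=> [/osp_homogP/(rep_linear hpi) hr /osp_homogP/(rep_linear hpi) hi] _.
rewrite /complexified [pi (Re_mx Y) u + _]addrC hr hi.
rewrite !scalerDr scalerA im_unit_sqr scaleN1r !addrA.
by rewrite [LHS](ACl (2*3*1*4)).
Qed.

Lemma complexified_bracket s t X Y u : ospC_homog s X -> ospC_homog t Y ->
  piC (superbracketC s t X Y) u
  = piC X (piC Y u) - (-1) ^+ (s && t) *: piC Y (piC X u).
Proof.
move=> hX hY; rewrite (complexified_comp _ hX hY) (complexified_comp _ hY hX).
case: hX hY => [Xr Xi] [Yr Yi].
have osp_sb (A B : 'M[R]_(m + m + N)) :
    osp_homog s A -> osp_homog t B -> osp (superbracket s t A B).
  by move=> hA hB; exact: osp_homogP (osp_homog_bracket hA hB).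
rewrite /complexified Re_superbracketC Im_superbracketC.
rewrite -[superbracket s t (Re_mx X) (Im_mx Y)]scale1r !(rep_real_linear hpi) ?osp_sb //.
rewrite !(rep_bracket hpi) //; try exact: osp_sb.
rewrite rmorphN rmorph1 !scale1r scaleN1r.
set c := (-1) ^+ _.
rewrite !(opprD, scalerDr, scalerN, scalerA, opprK) [c * I]mulrC !addrA.
by rewrite [LHS](ACl (3*1*5*7*4*2*8*6)).
all: exact: osp_sb.
Qed.

Lemma complexified_mx0 u : piC 0 u = 0.
Proof.
have := @complexified_mx_lin true (-1) 0 0 u (ospC_homog0 _) (ospC_homog0 _).
by rewrite scaler0 addr0 scaleN1r addNr.
Qed.

Lemma complexified_mxZ s a Z u : ospC_homog s Z -> piC (a *: Z) u = a *: piC Z u.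
Proof.
move=> hZ; rewrite -[a *: Z]addr0.
by rewrite (complexified_mx_lin _ _ hZ (ospC_homog0 s)) complexified_mx0 addr0.
Qed.

Lemma rep0 u : pi 0 u = 0.
Proof.
have o0 : osp (0 : 'M[R]_(m + m + N)) by apply: osp_homogP (osp_homog0 true).
have := rep_real_linear hpi (-1) u o0 o0.
by rewrite scaler0 addr0 rmorphN1 scaleN1r addNr.
Qed.

Lemma complexified_real_mx X u : piC (toC X) u = pi X u.
Proof.
rewrite /complexified Re_toC Im_toC.
by rewrite rep0 scaler0 addr0.
Qed.

Variables (ip : {dot V for @Num.conj R[i]}) (eps j : R[i]).
Hypothesis j_sqr : j ^+ 2 = eps * I.
Hypothesis ip_odd : forall X v w, osp_homog true X ->
  ip (j *: pi X v) w = ip v (j *: pi X w).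

(* The factor [j] turns the condition on odd elements in the definition of super
   unitarity into: the adjoint of [odd_op B] is [odd_op] of the conjugate of [B]. *)
Definition odd_op B u : V := j *: piC (odd_mx B) u.
Local Notation q := odd_op.

Lemma odd_op_linear B : linear (q B).
Proof.
move=> a u w; rewrite /q (complexified_linear (ospC_homog_odd_mx B)) scalerDr !scalerA.
by rewrite mulrC.
Qed.

HB.instance Definition _ B := GRing.isLinear.Build _ _ _ _ (q B) (odd_op_linear B).

Definition odd_lin B : {linear V -> V} := q B.

Lemma odd_op_lin a B B' u : q (a *: B + B') u = a *: q B u + q B' u.
Proof.
rewrite /q odd_mxP (complexified_mx_lin _ _ (ospC_homog_odd_mx B) (ospC_homog_odd_mx B')).
by rewrite scalerDr !scalerA mulrC.
Qed.

(** On real matrices [j *: pi] is self-adjoint; the factor [I] of the imaginary part is conjugated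
    when it changes sides, which conjugates [B]. *)
Lemma odd_op_adj B u w : ip (q B u) w = ip u (q (map_mx Num.conj B) w).
Proof.
have qE B' z :
    q B' z = j *: (pi (odd_mx (Re_mx B')) z + I *: pi (odd_mx (Im_mx B')) z).
  by rewrite -Re_odd_mx -Im_odd_mx.
rewrite (qE B u) (qE _ w).
have -> : Re_mx (map_mx Num.conj B) = Re_mx B.
  by apply/matrixP => r s; rewrite !mxE; case: (B r s).
have -> : Im_mx (map_mx Num.conj B) = -1 *: Im_mx B + 0.
  by rewrite addr0 scaleN1r; apply/matrixP => r s; rewrite !mxE; case: (B r s).
rewrite odd_mxP odd_mx0.
have o B' : osp (@odd_mx R m N B') by exact: osp_homogP (osp_homog_odd_mx B').
have o0 := osp_homogP (osp_homog0 true).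
rewrite (rep_real_linear hpi) //.
rewrite rep0 addr0 rmorphN1 scaleN1r scalerN.
have sw B' z : j *: (I *: pi (odd_mx B') z) = I *: (j *: pi (odd_mx B') z).
  by rewrite !scalerA mulrC.
rewrite scalerDr scalerBr !sw linearDl linearBr /= !(ip_odd _ _ (osp_homog_odd_mx _)).
rewrite [ip (I *: _) _]linearZl_LR [ip _ (I *: _)]linearZr_LR /=.
rewrite (ip_odd _ _ (osp_homog_odd_mx _)) /im_unit complexiE conjCi mulNr opprK //.
Qed.

Lemma j_sqrZ (w : V) : j *: (j *: w) = (eps * I) *: w.
Proof. by rewrite scalerA -expr2 j_sqr. Qed.

(** The two factors [j] combine to [j ^+ 2 = eps * I]; the rest is the bracket of two odd elements,
    which is an anticommutator. *)
Lemma odd_op_anticomm B B' u : q B (q B' u) + q B' (q B u)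
  = (eps * I) *: piC (odd_mx B *m odd_mx B' + odd_mx B' *m odd_mx B) u.
Proof.
have hB := ospC_homog_odd_mx B; have hB' := ospC_homog_odd_mx B'.
have := complexified_bracket u hB hB'.
rewrite /superbracketC /= expr1 !scaleN1r !opprK => ->.
have c B1 B2 : q B1 (q B2 u) = (eps * I) *: piC (odd_mx B1) (piC (odd_mx B2) u).
  exact: etrans (congr1 (GRing.scale j) (complexifiedZ _ _ (ospC_homog_odd_mx _))) (j_sqrZ _).
rewrite (c B B') (c B' B).
exact: esym (scalerDr _ _ _).
Qed.

(** The anticommutator of the first two operators is [eps * I] times the even element [X];
    bracketing [X] with the third leaves a single [j], as in [q]. *)
Lemma odd_op_triple B B' B'' u :
  q B (q B' (q B'' u)) + q B' (q B (q B'' u)) - (q B'' (q B (q B' u)) + q B'' (q B' (q B u)))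
  = (eps * I) *: q (odd_triple B B' B'') u.
Proof.
pose X := odd_mx B *m odd_mx B' + odd_mx B' *m odd_mx B.
have hX : ospC_homog false X.
  have := ospC_homog_bracket (ospC_homog_odd_mx B) (ospC_homog_odd_mx B').
  by rewrite /superbracketC /= expr1 scaleN1r opprK.
have e1 : q B (q B' (q B'' u)) + q B' (q B (q B'' u)) = (eps * I) *: piC X (q B'' u).
  exact: odd_op_anticomm B B' (q B'' u).
have e2 : q B'' (q B (q B' u)) + q B'' (q B' (q B u)) = (eps * I) *: q B'' (piC X u).
  apply: etrans (esym (linearD (q B'') _ _)) _.
  apply: etrans (congr1 (q B'') (odd_op_anticomm B B' u)) _.
  exact: (linearZ_LR (q B'')).
have e3 : q (odd_triple B B' B'') u = piC X (q B'' u) - q B'' (piC X u).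
  have e4 : odd_mx (odd_triple B B' B'') = superbracketC false true X (odd_mx B'').
    by rewrite /superbracketC expr0 scale1r -odd_mx_triple.
  have e5 := complexified_bracket u hX (ospC_homog_odd_mx B'').
  rewrite expr0 scale1r -e4 in e5.
  have e6 : j *: piC X (piC (odd_mx B'') u) = piC X (q B'' u).
    exact: esym (complexifiedZ j (piC (odd_mx B'') u) hX).
  apply: etrans (congr1 (GRing.scale j) e5) _.
  apply: etrans (scalerBr _ _ _) _.
  exact: (congr1 (fun x : V => x - q B'' (piC X u)) e6).
apply: (etrans (congr2 (fun x y => x - y) e1 e2)).
apply: (etrans (esym (scalerBr _ _ _))).
exact: (congr1 (fun x : V => (eps * I) *: x) (esym e3)).
Qed.

End ComplexifiedRep.
End Complexification.

(** * Weight vectors *)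

Section WeightVectors.
Variables (C : numClosedFieldType) (m N : nat) (r0 r1 : 'I_N).
Hypothesis r01 : r0 != r1.

(* For s, t = 1 or -1 these are eigenvectors of the Cartan subalgebra, of weights
   s e_i and t f_1. *)
Definition symp_wvec (s : C) (i : 'I_m) : 'cV[C]_(m + m) :=
  col_mx (delta_mx i 0) ((s * 'i) *: delta_mx i 0).

Definition orth_wvec (t : C) : 'cV[C]_N :=
  delta_mx r0 0 + (t * 'i) *: delta_mx r1 0.

(** For signs [s] and [s'] this vanishes unless [s' = - s]: only opposite weights pair.
    [vdot_orth_wvec] behaves in the same way. *)
Lemma sdot_symp_wvec s s' i k :
  sdot (symp_wvec s i) (symp_wvec s' k) = (i == k)%:R * ('i * (s' - s)).
Proof.
rewrite /sdot /symp_wvec /symp_gram tr_col_mx mul_row_block mul_row_col.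
rewrite !mulmx0 add0r addr0 mulmx1 mulmxN mulmx1 linearZ /= trmx_delta.
rewrite mulNmx -scalemxAl -scalemxAr mul_delta_mx_cond !mxE.
by case: (i == k) => /=; rewrite ?mulr0n ?mulr1n !mxE ?eqxx /=; ring.
Qed.

Lemma vdot_delta (r r' : 'I_N) :
  vdot (delta_mx r 0) (delta_mx r' 0) = (r == r')%:R :> C.
Proof.
by rewrite /vdot trmx_delta mul_delta_mx_cond; case: (r == r'); rewrite !mxE.
Qed.

Lemma vdot_orth_wvec t t' : vdot (orth_wvec t) (orth_wvec t') = 1 - t * t'.
Proof.
rewrite /vdot /orth_wvec [(_ + _)^T]linearD /= [((t * _) *: _)^T]linearZ /= !trmx_delta.
rewrite mulmxDl !mulmxDr -!scalemxAl -!scalemxAr scalerA !mul_delta_mx_cond.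
rewrite !eqxx [r1 == r0]eq_sym (negPf r01) !mulr0n !scaler0 addr0 add0r !mxE !eqxx.
rewrite mulr1 (_ : t * 'i * (t' * 'i) = t * t' * 'i ^+ 2); last by ring.
by rewrite sqrCi mulrN1.
Qed.

(** For real [s] conjugation reverses the weight, which is why raising and lowering operators are
    adjoint to each other. *)
Lemma conj_symp_wvec s i : map_mx Num.conj (symp_wvec s i) = symp_wvec (- s^*) i.
Proof.
rewrite /symp_wvec map_col_mx map_mxZ !map_delta_mx; congr (col_mx _ (_ *: _)).
by rewrite rmorphM /= conjCi mulrN mulNr.
Qed.

Lemma conj_orth_wvec t : map_mx Num.conj (orth_wvec t) = orth_wvec (- t^*).
Proof.
rewrite /orth_wvec map_mxD map_mxZ !map_delta_mx; congr (_ + _ *: _).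
by rewrite rmorphM /= conjCi mulrN mulNr.
Qed.

Lemma symp_wvec_cartan i :
  (symp_wvec (-1) i *m (symp_wvec 1 i)^T + symp_wvec 1 i *m (symp_wvec (-1) i)^T)
    *m symp_gram C m = 2 *: cartan_symp (delta_mx 0 i).
Proof.
have e : diag_mx (delta_mx 0 i) = delta_mx i i :> 'M[C]_m.
  apply/matrixP => k l; rewrite !mxE eqxx /=.
  case: (eqVneq k l) => [->|kl]; first by rewrite mulr1n andbb.
  rewrite mulr0n; case: (eqVneq k i) kl => [->|_ _] //= il.
  by rewrite eq_sym (negPf il).
rewrite /symp_wvec /cartan_symp /symp_gram e !tr_col_mx ![(_ *: _)^T]linearZ /= !trmx_delta.
rewrite !mul_col_row add_block_mx -!scalemxAl -!scalemxAr !mul_delta_mx !scalerA.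
rewrite -!scalerDl mulmx_block !mulmx0 !add0r !mulmxN !mulmx1 !addr0.
rewrite scale_block_mx !scaler0 scalerN -[X in block_mx _ (X + _)]scale1r.
have -> : 1 * 'i + -1 * 'i = 0 :> C by ring.
have -> : -1 * 'i + 1 * 'i = 0 :> C by ring.
have -> : -1 * 'i * (1 * 'i) + 1 * 'i * (-1 * 'i) = 2 :> C.
  by transitivity (- ('i ^+ 2) * 2 : C); [ring|rewrite sqrCi opprK mul1r].
by rewrite !scale0r oppr0 scale1r -mulr2n scaler_nat.
Qed.

Lemma orth_wvec_cartan :
  orth_wvec 1 *m (orth_wvec (-1))^T - orth_wvec (-1) *m (orth_wvec 1)^T
  = (- 2 * 'i) *: (delta_mx r0 r1 - delta_mx r1 r0).
Proof.
apply/matrixP => k l; rewrite !mxE !big_ord1 !mxE !eqxx !andbT -!mulnb !natrM.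
by ring.
Qed.

(** For signs [s] and [t], the parameter of an odd root vector of weight s e_i + t f_1. *)
Definition wtensor s t i : 'M[C]_(m + m, N) := symp_wvec s i *m (orth_wvec t)^T.

(** Opposite root vectors bracket to the Cartan element with a_i = b_1 = 1 and all other coordinates
    0, on which the lowest weight takes the value ['i] times lambda_i + mu_1. *)
Lemma wtensor_anticomm i :
  odd_mx (wtensor (-1) 1 i) *m odd_mx (wtensor 1 (-1) i)
    + odd_mx (wtensor 1 (-1) i) *m odd_mx (wtensor (-1) 1 i)
  = 4 *: even_mx (cartan_symp (delta_mx 0 i)) (delta_mx r0 r1 - delta_mx r1 r0).
Proof.
rewrite odd_mx_anticomm !mul_rank1_tr !tr_mul_rank1 !vdot_orth_wvec // !sdot_symp_wvec.
rewrite eqxx !mul1r mulr1 !opprK -scalerDr -scalemxAl symp_wvec_cartan.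
rewrite -opprD mulrN scaleNr -scalerBr orth_wvec_cartan !scalerA.
rewrite even_mxZ; congr (even_mx (_ *: _) (_ *: _)); first by ring.
by transitivity (- ('i ^+ 2) * 4 : C); [ring|rewrite sqrCi opprK mul1r].
Qed.

(** With a real vector as orthogonal factor the lower blocks cancel, so the Cartan element obtained
    sees lambda_i alone. *)
Lemma symp_wvec_delta_anticomm i r :
  let B s := symp_wvec s i *m (delta_mx r 0 : 'cV[C]_N)^T in
  odd_mx (B (-1)) *m odd_mx (B 1) + odd_mx (B 1) *m odd_mx (B (-1))
  = 2 *: even_mx (cartan_symp (delta_mx 0 i)) 0.
Proof.
rewrite /= odd_mx_anticomm !mul_rank1_tr !tr_mul_rank1 !vdot_delta !sdot_symp_wvec.
rewrite !eqxx !mul1r !scale1r symp_wvec_cartan -scalerDl.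
rewrite -mulrDr addrA subrK subrr mulr0 scale0r.
by rewrite even_mxZ scaler0.
Qed.

End WeightVectors.

(** * Norm constraints from the odd operators *)

Section OddOperators.
Variables (C : numClosedFieldType) (m N : nat) (r0 r1 : 'I_N).
Hypothesis r01 : r0 != r1.
Local Notation wtensor := (@wtensor C m N r0 r1).
Variables (V : lmodType C) (ip : {dot V for @Num.conj C}).
Variables (q : 'M[C]_(m + m, N) -> {linear V -> V}) (eps : C).
Hypothesis qlin : forall a B B' u, q (a *: B + B') u = a *: q B u + q B' u.
Hypothesis qadj : forall B u w, ip (q B u) w = ip u (q (map_mx Num.conj B) w).
Hypothesis qanti : forall B B' u,
  (B *m B'^T + B' *m B^T) *m symp_gram C m = 0 ->
  B^T *m symp_gram C m *m B' + B'^T *m symp_gram C m *m B = 0 ->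
  q B (q B' u) + q B' (q B u) = 0.
Hypothesis qtriple : forall B B' B'' u,
  q B (q B' (q B'' u)) + q B' (q B (q B'' u))
    - (q B'' (q B (q B' u)) + q B'' (q B' (q B u)))
  = (eps * 'i) *: q (odd_triple B B' B'') u.

Variables (v : V) (lam : 'I_m -> C) (mu : C).
Hypothesis v_neq0 : v != 0.
Hypothesis q_low : forall i t, t ^+ 2 = 1 -> q (wtensor (-1) t i) v = 0.
Hypothesis q_low2 : forall i k : 'I_m, (i < k)%N ->
  q (wtensor (-1) 1 i) (q (wtensor 1 (-1) k) v) = 0.
Hypothesis q_cartan : forall i,
  q (wtensor (-1) 1 i) (q (wtensor 1 (-1) i) v) = (- 4 * eps * (lam i + mu)) *: v.
Hypothesis q_cartan_symp : forall i r,
  q (symp_wvec (-1) i *m (delta_mx r 0)^T) v = 0 ->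
  q (symp_wvec (-1) i *m (delta_mx r 0)^T) (q (symp_wvec 1 i *m (delta_mx r 0)^T) v)
  = (- 2 * eps * lam i) *: v.

Let q0 u : q 0 u = 0.
Proof. by have := qlin (-1) 0 0 u; rewrite scaler0 addr0 scaleN1r addNr. Qed.

Let qZ a B u : q (a *: B) u = a *: q B u.
Proof. by have := qlin a B 0 u; rewrite q0 !addr0. Qed.

Let conj_wtensor s t i : map_mx Num.conj (wtensor s t i) = wtensor (- s^*) (- t^*) i.
Proof. by rewrite /wtensor map_mxM -map_trmx conj_symp_wvec conj_orth_wvec. Qed.

(** Two of the four terms contain a pairing of equal signs and vanish; in the other two the pairings
    [2] and [2 * 'i] multiply to [4 * 'i]. This is the gl(m|1) relation up to scale. *)
Let wtensor_triple i k l :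
  odd_triple (wtensor (-1) 1 i) (wtensor 1 (-1) k) (wtensor 1 (-1) l)
  = (4 * 'i) *: ((i == l)%:R *: wtensor 1 (-1) k - (i == k)%:R *: wtensor 1 (-1) l).
Proof.
rewrite odd_triple_rank1 !sdot_symp_wvec !vdot_orth_wvec //.
have lincomb (W : lmodType C) (a b c d a' b' : C) (x y z w : W) :
  a = 0 -> d = 0 -> b = a' -> c = b' ->
    a *: x + b *: y - (c *: z + d *: w) = a' *: y - b' *: z.
  by move=> -> -> -> ->; rewrite !scale0r add0r addr0.
by rewrite scalerBr !scalerA; apply: lincomb; ring.
Qed.

(** For [eps = -1] the constant is 4 both in the triple relation and in [q_cartan]; halving each
    operator turns it into 1, and since the factor is real, adjointness is kept. *)
Let half : C := 2^-1.
Let half_conj : half^* = half.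
Proof. by rewrite fmorphV rmorph_nat. Qed.
Let Q i : {linear V -> V} := q (half *: wtensor 1 (-1) i).
Let P i : {linear V -> V} := q (half *: wtensor (-1) 1 i).

Let ladder_trichotomy (i0 : 'I_m) : eps = -1 -> i0 = 0%N :> nat ->
  let x := lam i0 + mu in let d := #|[set i | lam i0 < lam i]| in
  (exists p : nat, (d <= p <= m.-1)%N /\ x = p%:R) \/ (m.-1)%:R <= x.
Proof.
move=> eps1 i00.
have dE : [set i | lam i0 < lam i] = [set i | lam i0 + mu < lam i + mu].
  by apply/setP => i; rewrite !inE ltrD2r.
rewrite /= dE; apply: (@ladder_value_trichotomy _ _ ip m Q P v (fun i => lam i + mu)) => //.
- move=> i u w; rewrite qadj map_mxZ conj_wtensor rmorphN1 opprK rmorph1.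
  by congr (ip u (q (_ *: _) w)); exact: half_conj.
(* The two tensors have equal signs, so both pairings vanish and [qanti] applies. *)
- move=> i k u; apply/eqP; rewrite -addr_eq0; apply/eqP.
  rewrite /Q !qZ !linearZ_LR /= -!scalerDr qanti ?scaler0 //.
    by rewrite !mul_rank1_tr !vdot_orth_wvec // mulrNN mulr1 subrr !scale0r addr0 mul0mx.
  by rewrite !tr_mul_rank1 !sdot_symp_wvec !subrr !mulr0 !scale0r addr0.
- move=> i k l u; rewrite qtriple odd_tripleZ wtensor_triple eps1 qZ qZ.
  have -> (a b : C) X Y : q (a *: X - b *: Y) u = a *: q X u - b *: q Y u.
    by rewrite qlin -scaleNr qZ scaleNr.
  rewrite /Q !qZ !scalerA -[_ * half * half]mulrA.
  have -> : -1 * 'i * (half * (half * half)) * (4 * 'i) = half.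
    transitivity (- 'i ^+ 2 * half * (half * 2) ^+ 2); first by ring.
    by rewrite sqrCi opprK mul1r /half mulVf ?pnatr_eq0 // expr1n mulr1.
  by rewrite scalerBr !scalerA ![half * _]mulrC.
- by move=> i; rewrite /P qZ q_low ?expr1n // scaler0.
- move=> i k ik; rewrite /P /Q !qZ linearZ_LR /= q_low2 // !scaler0 //.
- move=> i; rewrite /P /Q !qZ linearZ_LR /= q_cartan eps1 !scalerA.
  by rewrite /half; congr (_ *: _); field.
Qed.

(** As the orthogonal factor is real, the tensors for [s = 1] and [s = -1] with the same [r] give
    adjoint operators; they isolate lambda_i. *)
Let real_tensor s (r : 'I_N) i : 'M[C]_(m + m, N) := symp_wvec s i *m (delta_mx r 0)^T.

Let conj_real_tensor s r i : map_mx Num.conj (real_tensor s r i) = real_tensor (- s^*) r i.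
Proof. by rewrite /real_tensor map_mxM -map_trmx conj_symp_wvec map_delta_mx. Qed.

Let wtensorE s t i : wtensor s t i = (t * 'i) *: real_tensor s r1 i + real_tensor s r0 i.
Proof.
by rewrite /wtensor /orth_wvec linearD /= linearZ /= mulmxDr -scalemxAr addrC.
Qed.

(** The lowering tensors for [t = 1] and [t = -1] both kill [v], and they span the same plane as the
    real tensors at [r0] and [r1]. *)
Let real_tensor_low i r : r \in [:: r0; r1] -> q (real_tensor (-1) r i) v = 0.
Proof.
have p := @q_low i 1 (expr1n _ _); have n : q (wtensor (-1) (-1) i) v = 0.
  by apply: q_low; rewrite sqrrN expr1n.
move: p n; rewrite !wtensorE !qlin mul1r mulN1r scaleNr.
set a := q (real_tensor _ r1 i) v; set b := q (real_tensor _ r0 i) v => p n.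
have b_ia : b = 'i *: a by apply/eqP; rewrite -subr_eq0 addrC n.
have a0 : a = 0.
  apply/eqP; have := eqxx (0 : V); rewrite -[X in X == _]p b_ia -mulr2n -scaler_nat.
  by rewrite !scaler_eq0 pnatr_eq0 (negPf (neq0Ci C)).
by rewrite !inE => /orP[]/eqP ->; rewrite -/a -/b ?b_ia a0 ?scaler0.
Qed.

Let real_tensor_triple i r :
  odd_triple (real_tensor (-1) r i) (real_tensor 1 r i) (real_tensor 1 r i)
  = (2 * 'i) *: real_tensor 1 r i.
Proof.
rewrite odd_triple_rank1 !sdot_symp_wvec !vdot_delta !eqxx.
rewrite -scalerDl subrr !mulr0 scale0r add0r -scalerBl.
by congr (_ *: _); rewrite /=; ring.
Qed.

Let norm_real_tensor i r : r \in [:: r0; r1] ->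
  ip (q (real_tensor 1 r i) v) (q (real_tensor 1 r i) v) = - 2 * eps * lam i * ip v v.
Proof.
move=> hr; have := qadj (real_tensor (-1) r i) (q (real_tensor 1 r i) v) v.
by rewrite conj_real_tensor rmorphN1 opprK q_cartan_symp ?real_tensor_low // linearZl_LR => <-.
Qed.

(* [s] is odd, so s^2 = {s, s} / 2 is the even raising operator of weight 2 e_i;
   the squared norm of s^2 v is 4 lam_i |v|^2. *)
Let lam_ge0 i : eps ^+ 2 = 1 -> 0 <= lam i.
Proof.
move=> eps2; set s := q (real_tensor 1 r0 i); set t := q (real_tensor (-1) r0 i).
(* In the triple relation the terms [s (t (s v))] cancel, and [t v = 0] removes the last one. *)
have tss : t (s (s v)) = (- 2 * eps) *: s v.
  have := qtriple (real_tensor (-1) r0 i) (real_tensor 1 r0 i) (real_tensor 1 r0 i) v.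
  rewrite real_tensor_triple -/s -/t qZ.
  rewrite real_tensor_low ?mem_head // !linear0 addr0 addrK => ->.
  rewrite scalerA (_ : eps * 'i * (2 * 'i) = 2 * eps * 'i ^+ 2); last by ring.
  by rewrite sqrCi mulrN1 mulNr.
have adj u w : ip (t u) w = ip u (s w).
  by rewrite qadj conj_real_tensor rmorphN1 opprK.
have := dnorm_ge0 ip (s (s v)).
rewrite -!adj tss linearZ_LR /=.
rewrite q_cartan_symp ?real_tensor_low ?mem_head // scalerA linearZl_LR.
rewrite (_ : - 2 * eps * (- 2 * eps * lam i) = eps ^+ 2 * 4 * lam i); last by ring.
by rewrite eps2 mul1r pmulr_lge0 ?dnorm_gt0 // pmulr_rge0.
Qed.

Lemma odd_operators_trichotomy (i0 : 'I_m) : eps = 1 \/ eps = -1 -> i0 = 0%N :> nat ->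
  let x := lam i0 + mu in let d := #|[set i | lam i0 < lam i]| in
  (exists p : nat, (d <= p <= m.-1)%N /\ x = p%:R) \/ (m.-1)%:R <= x.
Proof.
move=> [eps1|]; last exact: ladder_trichotomy.
move=> _.
have lam0 i : lam i = 0.
  apply/le_anti; rewrite lam_ge0 ?eps1 ?expr1n // andbT.
  have := dnorm_ge0 ip (q (real_tensor 1 r0 i) v).
  rewrite norm_real_tensor ?mem_head // pmulr_lge0 ?dnorm_gt0 // eps1 mulr1.
  by rewrite mulNr oppr_ge0 pmulr_rle0.
(* The norms are multiples of [lam i = 0], so the raising operators kill [v] too; [q_cartan] then
   forces [lam i0 + mu = 0], and [d = 0] because all the [lam i] agree. *)
have s0 i r : r \in [:: r0; r1] -> q (real_tensor 1 r i) v = 0.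
  move=> hr; apply/eqP; rewrite -(dnorm_eq0 ip) norm_real_tensor //.
  by rewrite lam0 mulr0 mul0r.
have /eqP := q_cartan i0; rewrite (wtensorE 1 (-1)) qlin !s0 ?inE ?eqxx ?orbT //.
rewrite scaler0 addr0 linear0 eq_sym scaler_eq0 (negPf v_neq0) orbF eps1.
rewrite !mulf_eq0 oppr_eq0 pnatr_eq0 oner_eq0 /= => /eqP x0; left; exists 0%N.
split=> //; rewrite andbT leqn0 cards_eq0; apply/eqP/setP => i.
by rewrite !inE !lam0 ltxx.
Qed.

End OddOperators.

(** * Root spaces and the Cartan subalgebra *)

(** The commutator with [H] is a derivation, so eigenvalues add on products. *)
Lemma mx_comm_anticomm (K : comNzRingType) p (H X Y : 'M[K]_p) x y :
  H *m X - X *m H = x *: X -> H *m Y - Y *m H = y *: Y ->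
  H *m (X *m Y + Y *m X) - (X *m Y + Y *m X) *m H = (x + y) *: (X *m Y + Y *m X).
Proof.
have comm X' Y' x' y' : H *m X' - X' *m H = x' *: X' -> H *m Y' - Y' *m H = y' *: Y' ->
    H *m (X' *m Y') - X' *m Y' *m H = (x' + y') *: (X' *m Y').
  move=> hX hY; rewrite scalerDl scalemxAl scalemxAr -hX -hY mulmxBl mulmxBr !mulmxA.
  by rewrite addrA subrK.
move=> hX hY; rewrite mulmxDr mulmxDl opprD addrACA (comm _ _ _ _ hX hY) (comm _ _ _ _ hY hX).
by rewrite [y + x]addrC scalerDr.
Qed.

Section Cartan.
Variables (R : realType) (m n N : nat).
Local Notation I := ('i : R[i]).
Local Notation toC := (map_mx (real_complex R)).

Lemma im_unitE : im_unit R = 'i.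
Proof. exact: complexiE. Qed.

Lemma rotation_blocks_skew (b : 'rV[R]_n) :
  (rotation_blocks N b)^T + rotation_blocks N b = 0.
Proof.
apply/matrixP => k l; rewrite !mxE -big_split big1 //= => j _.
by rewrite -mulrDr ![(l == _ :> nat) && _]andbC addrA subrK subrr mulr0.
Qed.

Lemma toC_cartan (a : 'rV[R]_m) (b : 'rV[R]_n) :
  toC (cartan N a b) = even_mx (cartan_symp (toC a)) (toC (rotation_blocks N b)).
Proof.
by rewrite /cartan /even_mx /cartan_symp !map_block_mx !map_mx0 map_mxN map_diag_mx.
Qed.

Lemma mul_cartan_symp_wvec (a : 'rV[R[i]]_m) s k : s ^+ 2 = 1 ->
  cartan_symp a *m symp_wvec s k = (s * I * a 0 k) *: symp_wvec s k.
Proof.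
move=> s2; rewrite /cartan_symp /symp_wvec mul_block_col !mul0mx add0r addr0 scale_col_mx.
have e : diag_mx a *m delta_mx k 0 = a 0 k *: (delta_mx k 0 : 'cV[R[i]]_m).
  apply/matrixP => i j; rewrite mul_diag_mx !mxE.
  by case: eqP => [->|_] //=; rewrite !mulr0.
rewrite mulNmx -scalemxAr e !scalerA; congr col_mx.
rewrite -scaleNr; congr (_ *: _).
transitivity (s ^+ 2 * I ^+ 2 * a 0 k); last by ring.
by rewrite s2 sqrCi mul1r mulN1r.
Qed.

Variables (r0 r1 : 'I_N) (j1 : 'I_n).
Hypotheses (r0E : r0 = 0%N :> nat) (r1E : r1 = 1%N :> nat) (j1E : j1 = 0%N :> nat).

Lemma rotation_blocks_col0 (b : 'rV[R]_n) :
  rotation_blocks N b *m delta_mx r0 0 = - b 0 j1 *: (delta_mx r1 0 : 'cV_N).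
Proof.
apply/matrixP => k l; rewrite -colE !mxE (bigD1 j1) //= big1 ?addr0 => [|j].
  rewrite r0E j1E /= andbF -(inj_eq val_inj) /= r1E andbT ord1 eqxx andbT.
  by rewrite sub0r mulrN mulNr.
rewrite -(inj_eq val_inj) /= j1E r0E => j0.
have -> : (0 == j.*2)%N = false by apply/negP => /eqP; move/eqP: j0; lia.
by rewrite !andbF subrr mulr0.
Qed.

Lemma rotation_blocks_col1 (b : 'rV[R]_n) :
  rotation_blocks N b *m delta_mx r1 0 = b 0 j1 *: (delta_mx r0 0 : 'cV_N).
Proof.
apply/matrixP => k l; rewrite -colE !mxE (bigD1 j1) //= big1 ?addr0 => [|j].
  by rewrite r1E j1E /= andbF -(inj_eq val_inj) /= r0E andbT ord1 eqxx andbT subr0.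
rewrite -(inj_eq val_inj) /= j1E r1E => j0.
have -> : (1 == j.*2.+1)%N = false by apply/negP => /eqP; move/eqP: j0; lia.
have -> : (1 == j.*2)%N = false by apply/negP => /eqP; lia.
by rewrite !andbF subrr mulr0.
Qed.

Lemma mul_rotation_blocks_wvec (b : 'rV[R]_n) t : t ^+ 2 = 1 ->
  toC (rotation_blocks N b) *m orth_wvec r0 r1 t
  = (t * I * (b 0 j1)%:C%C) *: orth_wvec r0 r1 t.
Proof.
move=> t2; rewrite /orth_wvec mulmxDr -scalemxAr.
rewrite -!(map_delta_mx (real_complex R)) -!map_mxM.
rewrite rotation_blocks_col0 rotation_blocks_col1 !map_mxZ rmorphN.
rewrite scalerDr !scalerA addrC; congr (_ + _ *: _).
transitivity (t ^+ 2 * I ^+ 2 * (b 0 j1)%:C%C); last by rewrite /=; ring.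
by rewrite t2 sqrCi mul1r mulN1r.
Qed.

Lemma eval_weightN (l : weight R m n) a b : eval_weight (- l) a b = - eval_weight l a b.
Proof.
rewrite /eval_weight opprD -!sumrN; congr (_ + _);
by apply: eq_bigr => i _; rewrite !mxE mulNr.
Qed.

Lemma eval_weightD (l l' : weight R m n) a b :
  eval_weight (l + l') a b = eval_weight l a b + eval_weight l' a b.
Proof.
rewrite /eval_weight addrACA -!big_split; congr (_ + _);
by apply: eq_bigr => i _; rewrite !mxE mulrDl.
Qed.

Lemma eval_wt_e (i : 'I_m) a b : eval_weight (wt_e R n i) a b = I * (a 0 i)%:C%C.
Proof.
rewrite /eval_weight /= (bigD1 i) //= !big1 ?addr0 => [|j _|j ji].
- by rewrite mxE !eqxx mul1r im_unitE.
- by rewrite mxE mul0r.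
- by rewrite mxE (negPf ji) mul0r.
Qed.

Lemma eval_wt_f (j : 'I_n) a b : eval_weight (wt_f R m j) a b = I * (b 0 j)%:C%C.
Proof.
rewrite /eval_weight /= big1 => [|i _]; last by rewrite mxE mul0r.
rewrite add0r (bigD1 j) //= big1 ?addr0 => [|i ji].
  by rewrite mxE !eqxx mul1r im_unitE.
by rewrite mxE (negPf ji) mul0r.
Qed.

Local Notation wt := (@wtensor R[i] m N r0 r1).

Lemma cartan_comm_wtensor s t (k : 'I_m) (a : 'rV[R]_m) (b : 'rV[R]_n) :
  s ^+ 2 = 1 -> t ^+ 2 = 1 ->
  toC (cartan N a b) *m odd_mx (wt s t k) - odd_mx (wt s t k) *m toC (cartan N a b)
  = (I * (s * (a 0 k)%:C%C + t * (b 0 j1)%:C%C)) *: odd_mx (wt s t k).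
Proof.
move=> s2 t2; rewrite toC_cartan even_odd_mx_comm; first last.
- by rewrite map_trmx -map_mxD rotation_blocks_skew map_mx0.
- exact: cartan_symp_skew.
have -> : cartan_symp (toC a) *m wt s t k = (s * I * (a 0 k)%:C%C) *: wt s t k.
  by rewrite /wtensor mulmxA mul_cartan_symp_wvec // mxE -scalemxAl.
(* Transposition turns right multiplication into left multiplication by the transposed rotation
   block, which is its negative; hence the sign. *)
have -> : wt s t k *m toC (rotation_blocks N b) = - (t * I * (b 0 j1)%:C%C) *: wt s t k.
  rewrite /wtensor -mulmxA -[toC _]trmxK -trmx_mul map_trmx.
  have -> : (rotation_blocks N b)^T = - rotation_blocks N b.
    by apply/eqP; rewrite -addr_eq0 rotation_blocks_skew.
  rewrite map_mxN mulNmx mul_rotation_blocks_wvec // -scaleNr linearZ /=.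
  by rewrite -scalemxAr.
rewrite -scalerBl -[_ *: wt _ _ _]addr0 odd_mxP odd_mx0 addr0; congr (_ *: _).
by rewrite opprK; ring.
Qed.

Lemma g_minus_root (alpha : weight R m n) (Z : 'M[R[i]]_(m + m + N)) :
  positive_root N alpha -> root_space (- alpha) Z -> g_minus n Z.
Proof.
move=> ha hZ; exists 1%N, (fun=> alpha), (fun=> Z); split=> //.
by rewrite big_ord1.
Qed.

Lemma g_minus_wtensor (t : R[i]) k : t ^+ 2 = 1 -> g_minus n (odd_mx (wt (-1) t k)).
Proof.
move=> t2; have hC := ospC_homogP (ospC_homog_odd_mx (wt (-1) t k)).
(* The sign [t = 1] belongs to the negative root -(e_k - f_1), and [t = -1] to -(e_k + f_1). *)
have /orP[/eqP t1|/eqP t1] : (t == 1) || (t == -1) by rewrite -sqrf_eq1 t2.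
- apply: (g_minus_root (pos_eBf R N k j1)); split=> // a b /=.
  rewrite cartan_comm_wtensor ?sqrrN ?expr1n // eval_weightN eval_weightD eval_weightN.
  by rewrite eval_wt_e eval_wt_f t1; congr (_ *: _); ring.
- apply: (g_minus_root (pos_eDf R N k j1)); split=> // a b /=.
  rewrite cartan_comm_wtensor ?sqrrN ?expr1n // eval_weightN eval_weightD.
  by rewrite eval_wt_e eval_wt_f t1; congr (_ *: _); ring.
Qed.

(** The weights -e_i + f_1 and e_k - f_1 add up to -(e_i - e_k), a negative even root because
    [i < k]. *)
Lemma g_minus_wtensor_anticomm (i k : 'I_m) : (i < k)%N ->
  g_minus n (odd_mx (wt (-1) 1 i) *m odd_mx (wt 1 (-1) k)
             + odd_mx (wt 1 (-1) k) *m odd_mx (wt (-1) 1 i)).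
Proof.
move=> ik; apply: (g_minus_root (pos_eBe R n N ik)); split.
  have := ospC_homog_bracket (ospC_homog_odd_mx (wt (-1) 1 i))
    (ospC_homog_odd_mx (wt 1 (-1) k)).
  by rewrite /superbracketC /= expr1 scaleN1r opprK => /ospC_homogP.
move=> a b /=; set H := map_mx _ _.
have n1 : (-1 : R[i]) ^+ 2 = 1 by rewrite sqrrN expr1n.
have hX := cartan_comm_wtensor i a b n1 (expr1n _ 2).
have hY := cartan_comm_wtensor k a b (expr1n _ 2) n1.
apply: etrans (mx_comm_anticomm hX hY) _; congr (_ *: _).
by rewrite eval_weightN eval_weightD eval_weightN !eval_wt_e; ring.
Qed.

Lemma rotation_blocks_delta :
  rotation_blocks N (delta_mx 0 j1) = delta_mx r0 r1 - delta_mx r1 r0 :> 'M[R]_N.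
Proof.
apply/matrixP => k l; rewrite !mxE (bigD1 j1) //= big1 ?addr0 => [|j jj1].
  by rewrite mxE !eqxx mul1r -!(inj_eq val_inj) /= r0E r1E j1E.
by rewrite mxE (negPf jj1) andbF mul0r.
Qed.

Lemma toC_cartan_delta (i : 'I_m) :
  toC (cartan N (delta_mx 0 i) (delta_mx 0 j1))
  = even_mx (cartan_symp (delta_mx 0 i)) (delta_mx r0 r1 - delta_mx r1 r0).
Proof.
by rewrite toC_cartan rotation_blocks_delta map_mxB !map_delta_mx.
Qed.

Lemma toC_cartan_delta0 (i : 'I_m) :
  toC (cartan N (delta_mx 0 i) (0 : 'rV[R]_n)) = even_mx (cartan_symp (delta_mx 0 i)) 0.
Proof.
rewrite toC_cartan map_delta_mx (_ : rotation_blocks N 0 = 0) ?map_mx0 //.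
by apply/matrixP => k l; rewrite !mxE big1 // => j _; rewrite mxE mul0r.
Qed.

End Cartan.

(** * The lowest weight vector *)

Section LowestWeight.
Variables (R : realType) (m n N : nat) (r0 r1 : 'I_N) (j1 : 'I_n).
Hypotheses (r0E : r0 = 0%N :> nat) (r1E : r1 = 1%N :> nat) (j1E : j1 = 0%N :> nat).
Variables (V0 V1 : lmodType R[i]).
Local Notation V := (V0 * V1)%type.
Variable pi : 'M[R]_(m + m + N) -> V -> V.
Hypothesis hpi : is_representation pi.
Variables (eps j : R[i]).
Hypothesis j_sqr : j ^+ 2 = eps * im_unit R.
Local Notation q := (odd_op pi j).
Local Notation wt := (@wtensor R[i] m N r0 r1).

Variables (v : V) (lam : weight R m n).
Hypothesis v_weight : forall a b, pi (cartan N a b) v = eval_weight lam a b *: v.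
Hypothesis v_low : forall Z, g_minus n Z -> complexified pi Z v = 0.

Lemma odd_op_wtensor_low i t : t ^+ 2 = 1 -> q (wt (-1) t i) v = 0.
Proof.
move=> t2; have Z0 := v_low (@g_minus_wtensor R m n N r0 r1 j1 r0E r1E j1E t i t2).
exact: etrans (congr1 (fun x : V => j *: x) Z0) (scaler0 _ j).
Qed.

(** On a vector killed by [q B] the anticommutator has a single surviving term. *)
Lemma odd_op_low_anticomm B B' : q B v = 0 -> q B (q B' v)
  = (eps * im_unit R) *: complexified pi (odd_mx B *m odd_mx B' + odd_mx B' *m odd_mx B) v.
Proof.
move=> qv0; have z : q B' (q B v) = 0.
  by rewrite qv0; exact: linear0 (odd_lin hpi j B').
have e := odd_op_anticomm hpi j_sqr B B' v.
apply: etrans e; apply: esym.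
exact: etrans (congr1 (fun x : V => q B (q B' v) + x) z) (addr0 _).
Qed.

Lemma odd_op_low_cartan B B' c (a : 'rV[R]_m) (b : 'rV[R]_n) : c != 0 -> q B v = 0 ->
  odd_mx B *m odd_mx B' + odd_mx B' *m odd_mx B
    = c *: map_mx (real_complex R) (cartan N a b) ->
  q B (q B' v) = (eps * im_unit R * (c * eval_weight lam a b)) *: v.
Proof.
move=> c0 qv0; set X := _ + _; set H := map_mx _ _ => hc.
(* As [c] is invertible, [H] is a multiple of the bracket [X] and lies in osp with it. *)
have hH : ospC_homog false H.
  have -> : H = c^-1 *: X by rewrite hc scalerA mulVf // scale1r.
  apply: ospC_homogZ.
  have := ospC_homog_bracket (ospC_homog_odd_mx B) (ospC_homog_odd_mx B').
  by rewrite /superbracketC /= expr1 scaleN1r opprK.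
have e : complexified pi X v = (c * eval_weight lam a b) *: v.
  rewrite hc; apply: etrans (complexified_mxZ hpi c v hH) _.
  have Hv : complexified pi H v = eval_weight lam a b *: v.
    exact: etrans (complexified_real_mx hpi _ v) (v_weight a b).
  apply: etrans (congr1 (fun x : V => c *: x) Hv) _.
  exact: scalerA.
apply: etrans (odd_op_low_anticomm B' qv0) _.
apply: etrans (congr1 (fun x : V => (eps * im_unit R) *: x) e) _.
exact: scalerA.
Qed.

Lemma odd_op_wtensor_low2 (i k : 'I_m) : (i < k)%N ->
  q (wt (-1) 1 i) (q (wt 1 (-1) k) v) = 0.
Proof.
move=> ik; have qv0 := odd_op_wtensor_low i (expr1n _ 2).
apply: etrans (odd_op_low_anticomm (wt 1 (-1) k) qv0) _.
have Z0 := v_low (@g_minus_wtensor_anticomm R m n N r0 r1 j1 r0E r1E j1E i k ik).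
exact: etrans (congr1 (fun x : V => (eps * im_unit R) *: x) Z0) (scaler0 _ _).
Qed.

Lemma eval_weight_delta i :
  eval_weight lam (delta_mx 0 i) (delta_mx 0 j1) = 'i * (lam.1 0 i + lam.2 0 j1).
Proof.
rewrite /eval_weight (bigD1 i) //= [X in _ + X](bigD1 j1) //=.
rewrite !big1 ?addr0 => [|k kj|k ki].
- by rewrite !mxE !eqxx im_unitE !mulr1 mulrDr ![_ * 'i]mulrC.
- by rewrite mxE (negPf kj) !mulr0.
- by rewrite mxE (negPf ki) !mulr0.
Qed.

Lemma eval_weight_delta0 i : eval_weight lam (delta_mx 0 i) 0 = 'i * lam.1 0 i.
Proof.
rewrite /eval_weight (bigD1 i) //= [X in _ + X]big1 => [|k _].
  rewrite big1 ?addr0 => [|k ki]; first by rewrite !mxE !eqxx im_unitE mulr1 mulrC.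
  by rewrite mxE (negPf ki) !mulr0.
by rewrite mxE !mulr0.
Qed.

(** The ['i] in [j ^+ 2] meets the ['i] in the value of the weight, so that the factor 4 of the
    bracket becomes [- 4 * eps]. *)
Lemma odd_op_wtensor_cartan i : q (wt (-1) 1 i) (q (wt 1 (-1) i) v)
  = (- 4 * eps * (lam.1 0 i + lam.2 0 j1)) *: v.
Proof.
have r01 : r0 != r1 by rewrite -(inj_eq val_inj) /= r0E r1E.
have qv0 := odd_op_wtensor_low i (expr1n _ 2).
have hc := etrans (@wtensor_anticomm R[i] m N r0 r1 r01 i)
  (congr1 (fun X => 4 *: X) (esym (@toC_cartan_delta R m n N r0 r1 j1 r0E r1E j1E i))).
apply: etrans (odd_op_low_cartan _ qv0 hc) _; first by rewrite pnatr_eq0.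
rewrite eval_weight_delta im_unitE; congr (_ *: _).
transitivity ('i ^+ 2 * 4 * eps * (lam.1 0 i + lam.2 0 j1) : R[i]); first by ring.
by rewrite sqrCi !mulNr !mul1r.
Qed.

Lemma odd_op_delta_cartan i r : q (symp_wvec (-1) i *m (delta_mx r 0)^T) v = 0 ->
  q (symp_wvec (-1) i *m (delta_mx r 0)^T) (q (symp_wvec 1 i *m (delta_mx r 0)^T) v)
  = (- 2 * eps * lam.1 0 i) *: v.
Proof.
move=> qv0; have hc := etrans (@symp_wvec_delta_anticomm R[i] m N i r)
  (congr1 (fun X => 2 *: X) (esym (@toC_cartan_delta0 R m n N i))).
apply: etrans (odd_op_low_cartan _ qv0 hc) _; first by rewrite pnatr_eq0.
rewrite eval_weight_delta0 im_unitE; congr (_ *: _).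
transitivity ('i ^+ 2 * 2 * eps * lam.1 0 i : R[i]); first by ring.
by rewrite sqrCi !mulNr !mul1r.
Qed.

End LowestWeight.

Theorem proposition4p3 (R : realType) (m n N : nat)
  (hm : (1 <= m)%N) (hN2 : (2 <= N)%N) (hN : N = n.*2 \/ N = n.*2.+1)
  (V0 V1 : lmodType R[i])
  (pi : 'M[R]_(m + m + N) -> (V0 * V1)%type -> (V0 * V1)%type)
  (hpi : is_representation pi)
  (irr : irreducible_rep pi)
  (lam : weight R m n)
  (hlow : lowest_weight_rep pi lam)
  (k : {pred 'M[R]_(m + m + N)})
  (hk : maximal_compact_subalgebra k)
  (hhk : forall (a : 'rV[R]_m) (b : 'rV[R]_n), cartan N a b \in k)
  (hadm : admissible pi k)
  (hunit : super_unitary pi) :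
  let i1 : 'I_m := Ordinal hm in
  let j1 : 'I_n := Ordinal (rank_gt0 hN hN2) in
  let x : R[i] := lam.1 0 i1 + lam.2 0 j1 in
  let d : nat := #|[set i : 'I_m | lam.1 0 i1 < lam.1 0 i]| in
  (exists p : nat, (d <= p <= m.-1)%N /\ x = p%:R) \/ (m.-1)%:R <= x.
Proof.
move=> i1 j1; case: hlow => v [v0 v_weight v_low _].
case: hunit => ip [eps [j [_ eps1 j_sqr _ ip_odd]]].
(* The rows 0 and 1 carry the first rotation block, that of f_1; [2 <= N] provides them. *)
pose r0 : 'I_N := Ordinal (ltnW hN2); pose r1 : 'I_N := Ordinal hN2.
have r0E : r0 = 0%N :> nat by [].
have r1E : r1 = 1%N :> nat by [].
have j1E : j1 = 0%N :> nat by [].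
have r01 : r0 != r1 by [].
have i1E : i1 = 0%N :> nat by [].
refine (@odd_operators_trichotomy R[i] m N r0 r1 r01 (V0 * V1)%type ip
  (odd_lin hpi j) eps _ _ _ _ v (fun i => lam.1 0 i) (lam.2 0 j1) v0 _ _ _ _ i1 eps1 i1E).
- exact: (odd_op_lin hpi j).
- exact: (odd_op_adj hpi ip_odd).
- move=> B B' u h1 h2; apply: etrans (odd_op_anticomm hpi j_sqr B B' u) _.
  have X0 : odd_mx B *m odd_mx B' + odd_mx B' *m odd_mx B = 0.
    apply: etrans (odd_mx_anticomm B B') _.
    by apply: etrans (congr2 (@even_mx _ m N) h1 h2) _; rewrite /even_mx block_mx0.
  have e : complexified pi (odd_mx B *m odd_mx B' + odd_mx B' *m odd_mx B) u = 0.
    by rewrite X0; exact: complexified_mx0 hpi u.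
  exact: etrans (congr1 (fun x : V0 * V1 => (eps * im_unit R) *: x) e) (scaler0 _ _).
- move=> B B' B'' u; rewrite -im_unitE; exact: (odd_op_triple hpi j_sqr B B' B'' u).
- exact: (odd_op_wtensor_low r0E r1E j1E j v_low).
- exact: (odd_op_wtensor_low2 r0E r1E j1E hpi j_sqr v_low).
- exact: (odd_op_wtensor_cartan r0E r1E j1E hpi j_sqr v_weight v_low).
- exact: (odd_op_delta_cartan hpi j_sqr v_weight).
Qed.
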